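(* Let $C\ge1$, $K\ge0$, and let $(X_n)$ be a sequence of finite connected graphs, each $(C,K)$-roughly transitive, with $|X_n|\to\infty$. There exists a constant $\delta>1$ such that if $|X_n| = O(\operatorname{diam}(X_n)^\delta)$, then the scaling limit of $(X_n)$ exists and is the circle $S^1$ (with its intrinsic length metric).
   Context: A $(C,K)$-quasi-isometry between metric spaces $X,Y$ is a map $f:X\to Y$ with $C^{-1}d(x,y)-K\le d(f(x),f(y))\le Cd(x,y)+K$ for all $x,y$, such that every point of $Y$ is within distance $K$ of $f(X)$. A metric space $X$ is $(C,K)$-roughly transitive if for all $x,y\in X$ there is a $(C,K)$-quasi-isometry $X\to X$ sending $x$ to $y$. Graphs carry the graph metric. The scaling limit of $(X_n)$: rescale the metric of $X_n$ by $1/\operatorname{diam}(X_n)$ to obtain $X'_n$; a compact metric space is the scaling limit if $X'_n$ converges to it in the Gromov–Hausdorff distance. *)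

(* Defs.v *)
From mathcomp Require Import all_boot.
From Stdlib Require Import Reals.

Set Implicit Arguments.
Unset Strict Implicit.
Unset Printing Implicit Defensive.

Section Graphs.
Variable T : finType.

Definition simple_graph (e : rel T) : Prop := symmetric e /\ irreflexive e.

Definition graph_connected (e : rel T) : Prop := forall x y : T, connect e x y.

Definition walkb (e : rel T) (x y : T) (k : nat) : bool :=
  [exists p : k.-tuple T, path e x p && (last x p == y)].

(* graph distance = length of a shortest walk (in a connected graph this is
   < #|T|, so the bounded search below finds it). *)
Definition gdist (e : rel T) (x y : T) : nat := find (walkb e x y) (iota 0 #|T|).

Definition graph_metric (e : rel T) : T -> T -> R :=
  fun x y => INR (gdist e x y).

Definition gdiam (e : rel T) : nat := \max_(x : T) \max_(y : T) gdist e x y.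

End Graphs.

Local Open Scope R_scope.

Definition is_metric {Z : Type} (d : Z -> Z -> R) : Prop :=
  forall x y z : Z,
    0 <= d x y /\ (d x y = 0 <-> x = y) /\ d x y = d y x /\ d x z <= d x y + d y z.

Definition quasi_isometry {X Y : Type} (dX : X -> X -> R) (dY : Y -> Y -> R)
  (C K : R) (f : X -> Y) : Prop :=
  (forall x y : X, / C * dX x y - K <= dY (f x) (f y) <= C * dX x y + K) /\
  (forall y : Y, exists x : X, dY y (f x) <= K).

Definition roughly_transitive {X : Type} (dX : X -> X -> R) (C K : R) : Prop :=
  forall x y : X, exists f : X -> X, quasi_isometry dX dX C K f /\ f x = y.

Definition isometric_embedding {X Z : Type} (dX : X -> X -> R) (dZ : Z -> Z -> R)
  (f : X -> Z) : Prop := forall x y : X, dZ (f x) (f y) = dX x y.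

Definition hausdorff_lt {X Y Z : Type} (dZ : Z -> Z -> R) (f : X -> Z) (g : Y -> Z)
  (eps : R) : Prop :=
  exists r : R, r < eps /\
    (forall a : X, exists b : Y, dZ (f a) (g b) <= r) /\
    (forall b : Y, exists a : X, dZ (f a) (g b) <= r).

Definition GH_lt {X Y : Type} (dX : X -> X -> R) (dY : Y -> Y -> R) (eps : R) : Prop :=
  exists (Z : Type) (dZ : Z -> Z -> R) (f : X -> Z) (g : Y -> Z),
    is_metric dZ /\ isometric_embedding dX dZ f /\ isometric_embedding dY dZ g /\
    hausdorff_lt dZ f g eps.

Definition GH_converges (X : nat -> Type) (d : forall n, X n -> X n -> R)
  {Y : Type} (dY : Y -> Y -> R) : Prop :=
  forall eps : R, 0 < eps ->
    exists N : nat, forall n : nat, leq N n -> GH_lt (d n) dY eps.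

Definition scaling_limit_is (T : nat -> finType) (E : forall n, rel (T n))
  {Y : Type} (dY : Y -> Y -> R) : Prop :=
  @GH_converges (fun n => Finite.sort (T n))
    (fun n x y => graph_metric (E n) x y / INR (gdiam (E n))) Y dY.

(* ---------- The circle with its intrinsic length metric ----------
   Normalized to diameter 1 (circumference 2), as a scaling limit must
   have diameter 1: the points are [0,2) and the distance is arc length. *)
Definition circle : Type := {t : R | 0 <= t < 2}.

Definition circle_dist (a b : circle) : R :=
  let t := Rabs (proj1_sig a - proj1_sig b) in Rmin t (2 - t).

(* Main.v *)
(** A graph with at most [A * D ^ delta] vertices, [D] its diameter, must at some scale [r] between a
    constant and [sqrt D] be line-like around one point: a geodesic of length about [Lambda * r]
    captures, up to [3 * r], the whole ball around its midpoint.  Otherwise every geodesic, at every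
    such scale, yields [Lambda + 1] disjoint smaller geodesics instead of [Lambda], which forces
    too many vertices.  Rough transitivity carries this picture to every point: at scale [r] there
    are no tripods and no dead ends anywhere.

    Now take a diametral geodesic [gam].  The graph continues beyond its far end to a point [p] off
    [gam]; a geodesic [sig] from [p] back to the start cannot pass the far end again, because the
    diameter is [D], and cannot meet [gam] earlier, because there are no tripods.  For the same
    reason everything lies close to [gam] or [sig], and a path between the two arcs passes near one
    of the common ends.  Hence the graph is within [O(r) = O(sqrt D)] of a circle of length
    [2 * D]. *)

Require Import Defs.
From Stdlib Require Import Classical Reals Lra.
From mathcomp Require Import all_boot.
From mathcomp Require Import zify.

Set Implicit Arguments.
Unset Strict Implicit.
Unset Printing Implicit Defensive.

(** * The shape of a space without tripods and dead ends *)

Definition geodesic (X : Type) (d : X -> X -> nat) (g : nat -> X) (n : nat) :=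
  forall i j, i <= j -> j <= n -> d (g i) (g j) = j - i.

Definition path_metric (X : Type) (d : X -> X -> nat) :=
  [/\ forall x, d x x = 0,
      forall x y, d x y = d y x,
      forall x y z, d x z <= d x y + d y z &
      forall x y, exists g,
        [/\ geodesic d g (d x y), g 0 = x & g (d x y) = y]].

(** * Geodesics, coarsely connected sets and nearest points *)

Section PathMetric.

Variables (X : Type) (d : X -> X -> nat).
Hypothesis Hd : path_metric d.

Let dxx : forall x, d x x = 0. Proof. by case: Hd. Qed.
Let dC : forall x y, d x y = d y x. Proof. by case: Hd. Qed.
Let dT : forall x y z, d x z <= d x y + d y z. Proof. by case: Hd. Qed.
Let dG : forall x y, exists g,
  [/\ geodesic d g (d x y), g 0 = x & g (d x y) = y].
Proof. by case: Hd. Qed.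

Lemma geodesicE g n i j : geodesic d g n -> i <= n -> j <= n ->
  d (g i) (g j) = (i - j) + (j - i).
Proof.
move=> Hg Hi Hj; case: (leqP i j) => H; first by rewrite Hg //; lia.
by rewrite dC Hg //; lia.
Qed.

(* Coarsely connected sets play the role of walks; they can be concatenated without reparametrizing. *)
Definition coarsely_connected (S : X -> Prop) :=
  forall (P : X -> Prop) x y, S x -> S y -> P x -> ~ P y ->
  exists u v, [/\ S u, S v, P u, ~ P v & d u v <= 1].

Definition segment (g : nat -> X) i j := fun v => exists2 k, i <= k <= j & v = g k.

Lemma nat_crossing (Q : nat -> Prop) a b : a <= b -> Q a -> ~ Q b ->
  exists c, [/\ a <= c, c < b, Q c & ~ Q c.+1].
Proof.
elim: b => [|b IH] Hab Qa Qb; first by move: Hab Qa; rewrite leqn0 => /eqP->.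
have [E|Hne] := eqVneq a b.+1; first by rewrite E in Qa.
case: (classic (Q b)) => Hb; first by exists b; split=> //; lia.
by case: (IH _ Qa Hb) => [|c [? ? ? ?]]; [lia | exists c; split=> //; lia].
Qed.

Lemma segment_connected g n i j : geodesic d g n -> j <= n ->
  coarsely_connected (segment g i j).
Proof.
move=> Hg Hj P _ _ [k Hk ->] [k' Hk' ->] Pk Pk'.
case: (leqP k k') => Hkk.
  have [c [c1 c2 Qc Qc']] := nat_crossing (Q := fun k => P (g k)) Hkk Pk Pk'.
  exists (g c), (g c.+1); split=> //; first by exists c => //; lia.
    by exists c.+1 => //; lia.
  by rewrite (geodesicE Hg); lia.
have [c [c1 c2 Qc Qc']] := nat_crossing (Q := fun k => ~ P (g k)) (ltnW Hkk) Pk' (fun f => f Pk).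
exists (g c.+1), (g c); split=> //; first by exists c.+1 => //; lia.
- by exists c => //; lia.
- exact: NNPP.
- by rewrite (geodesicE Hg); lia.
Qed.

Lemma union_connected (S S' : X -> Prop) z :
  coarsely_connected S -> coarsely_connected S' -> S z -> S' z ->
  coarsely_connected (fun v => S v \/ S' v).
Proof.
move=> HS HS' Sz S'z P x y Sx Sy Px Py.
have aux : forall A : X -> Prop, coarsely_connected A -> (forall v, A v -> S v \/ S' v) ->
  forall x y, A x -> A y -> P x -> ~ P y ->
  exists u v, [/\ S u \/ S' u, S v \/ S' v, P u, ~ P v & d u v <= 1].
  move=> A HA sA x' y' Ax Ay Px' Py'.
  have [u [v [? ? ? ? ?]]] := HA P x' y' Ax Ay Px' Py'.
  by exists u, v; split=> //; exact: sA.
case: (classic (P z)) => Pz.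
  case: Sy => Sy; first by apply: (aux S HS _ z y) => //; left.
  by apply: (aux S' HS' _ z y) => //; right.
case: Sx => Sx; first by apply: (aux S HS _ x z) => //; left.
by apply: (aux S' HS' _ x z) => //; right.
Qed.

Lemma curve_nearest (g : nat -> X) n y :
  exists2 i, i <= n & forall j, j <= n -> d y (g i) <= d y (g j).
Proof.
elim: n => [|n [i Hi IH]]; first by exists 0 => // j; rewrite leqn0 => /eqP->.
case: (leqP (d y (g i)) (d y (g n.+1))) => H.
  by exists i => [|j Hj]; [lia | have [->|] := eqVneq j n.+1 => // ?; apply: IH; lia].
exists n.+1 => // j Hj; have [->|?] := eqVneq j n.+1 => //.
by apply: leq_trans (ltnW H) (IH _ _); lia.
Qed.

(** * Tripods, dead ends and the exclusion of a third branch *)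

Definition in_ball q rho (S : X -> Prop) := forall v, S v -> d q v <= rho.
Definition far_from b a (S : X -> Prop) := forall v, S v -> b < d a v.

(** The arms are arbitrary coarsely connected sets, so that broken paths can serve as arms too. *)
Definition tripod_free rho b q := forall S1 S2 S3 a1 a2 a3,
  coarsely_connected S1 -> coarsely_connected S2 -> coarsely_connected S3 ->
  in_ball q rho S1 -> in_ball q rho S2 -> in_ball q rho S3 ->
  S1 q -> S2 q -> S3 q -> S1 a1 -> S2 a2 -> S3 a3 ->
  far_from b a1 S2 -> far_from b a1 S3 -> far_from b a2 S1 ->
  far_from b a2 S3 -> far_from b a3 S1 -> far_from b a3 S2 -> False.

(** The absence of a dead end: [q] coarsely separates two points of its ball, so the space continues
    on both sides. *)
Definition two_sided rho b h rho' q := exists p1 p2,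
  [/\ h <= d q p1, h <= d q p2, d q p1 <= rho', d q p2 <= rho' &
  forall S, coarsely_connected S -> in_ball q rho S -> S p1 -> S p2 ->
    exists2 v, S v & d q v <= b].

Section Global.

Variables (b rho rho' : nat).
Let m := b.*2.+1.
Hypothesis Hrho : 20 * m <= rho.
Hypothesis Hrho' : rho' + 5 * m <= rho.
Hypothesis Htri : forall q, tripod_free rho b q.
Hypothesis Htwo : forall q, two_sided rho b (6 * m) rho' q.

(** The geodesic from [q] to [y] would be a third arm. As [q] is, up to [e], the point of [S1] and
    [S2] nearest to [y], the point at distance [i] along this geodesic stays at least [i - e] away
    from both arms. *)
Lemma no_third_branch q S1 S2 a1 a2 y n n' e :
  coarsely_connected S1 -> coarsely_connected S2 ->
  in_ball q rho S1 -> in_ball q rho S2 -> S1 q -> S2 q -> S1 a1 -> S2 a2 ->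
  far_from b a1 S2 -> far_from b a2 S1 ->
  n' <= d q a1 -> n' <= d q a2 ->
  (forall v, S1 v -> d y q <= d y v + e) ->
  (forall v, S2 v -> d y q <= d y v + e) ->
  n <= rho -> b + e < n -> b.*2 + e < n' -> d y q < n.
Proof.
move=> c1 c2 B1 B2 q1 q2 h1 h2 f12 f21 l1 l2 e1 e2 Hn Hne Hn'.
rewrite ltnNge; apply/negP => Hy.
have [g [Hg g0 gn]] := dG q y.
have Hyq := dC y q.
have dqg i : i <= d q y -> d q (g i) = i.
  by move=> Hi; rewrite -[in LHS]g0 Hg // subn0.
have dyg i : i <= d q y -> d y (g i) = d q y - i.
  by move=> Hi; rewrite -[in LHS]gn (geodesicE Hg) //; lia.
have Hgv i (v : X) : i <= d q y -> d y q <= d y v + e -> i <= d (g i) v + e.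
  by move=> Hi Hv; have := dT y (g i) v; rewrite dyg //; lia.
(* The distance is at least [n' - i] by the triangle inequality and at least [i - e]; these bounds
   add up to more than [2b]. *)
have Hga i a : i <= n -> n' <= d q a -> d y q <= d y a + e -> b < d a (g i).
  move=> Hi Ha Hv; have := Hgv i a; have := dT q (g i) a; rewrite dqg ?(dC a); lia.
apply: (Htri (q := q) (S1 := S1) (S2 := S2) (S3 := segment g 0 n)
  (a1 := a1) (a2 := a2) (a3 := g n)) => //.
- by apply: (segment_connected Hg); lia.
- by move=> _ [k Hk ->]; rewrite dqg; lia.
- by exists 0.
- by exists n => //; lia.
- by move=> _ [k Hk ->]; apply: Hga; [lia | done | exact: e1].
- by move=> _ [k Hk ->]; apply: Hga; [lia | done | exact: e2].
- by move=> v Sv; have := Hgv n v; have := e1 _ Sv; lia.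
- by move=> v Sv; have := Hgv n v; have := e2 _ Sv; lia.
Qed.

(* A tripod centred at the point [g i] nearest to [y] is excluded, so [g i] is close to an end. *)
Lemma branch_near_ends g n y i : geodesic d g n -> i <= n ->
  (forall j, j <= n -> d y (g i) <= d y (g j)) ->
  m <= d y (g i) -> i < m \/ n - i < m.
Proof.
move=> Hg Hi Hmin Hy; case: (ltnP i m) => H1; first by left.
case: (ltnP (n - i) m) => H2; [by right|exfalso].
suff: d y (g i) < m by lia.
apply: (@no_third_branch (g i) (segment g (i - m) i) (segment g i (i + m))
  (g (i - m)) (g (i + m)) y m m 0) => //; rewrite ?(geodesicE Hg); try lia.
- by apply: (segment_connected Hg); lia.
- by apply: (segment_connected Hg); lia.
- by move=> _ [k Hk ->]; rewrite (geodesicE Hg); lia.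
- by move=> _ [k Hk ->]; rewrite (geodesicE Hg); lia.
- by exists i => //; lia.
- by exists i => //; lia.
- by exists (i - m) => //; lia.
- by exists (i + m) => //; lia.
- by move=> _ [k Hk ->]; rewrite (geodesicE Hg) /m; lia.
- by move=> _ [k Hk ->]; rewrite (geodesicE Hg) /m; lia.
- by move=> _ [k Hk ->]; rewrite addn0; apply: Hmin; lia.
- by move=> _ [k Hk ->]; rewrite addn0; apply: Hmin; lia.
Qed.


(** * Leaving the far end of a diametral geodesic *)

Variables (D : nat) (gam : nat -> X).
Hypothesis HD : forall x y, d x y <= D.
Hypothesis Hgam : geodesic d gam D.
Hypothesis Hlarge : 4 * rho <= D.

(** The geodesic [gam] stops at [gam D], so it can follow only one of the two sides there; the other
    side leads away from it. *)
Lemma exit_far_end : exists p,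
  (forall j, j <= D -> 5 * m <= d p (gam j)) /\ d (gam D) p <= 6 * m.
Proof.
have [p0 Hp0 Hp0']: exists2 p, (forall j, j <= D -> 5 * m <= d p (gam j)) & d (gam D) p <= rho'.
  have [p1 [p2 [h1 h2 r1 r2 HS]]] := Htwo (gam D).
  have [i1 Hi1 N1] := curve_nearest gam D p1.
  have [i2 Hi2 N2] := curve_nearest gam D p2.
  case: (leqP (5 * m) (d p1 (gam i1))) => F1.
    by exists p1 => // j Hj; apply: leq_trans F1 (N1 _ Hj).
  case: (leqP (5 * m) (d p2 (gam i2))) => F2.
    by exists p2 => // j Hj; apply: leq_trans F2 (N2 _ Hj).
  (* With both points near [gam], the path from [p1] to [gam], along [gam] and on to [p2] stays in
     the ball but avoids the [b]-neighbourhood of [gam D]. *)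
  exfalso.
  have [g1 [G1 g10 g1n]] := dG p1 (gam i1).
  have [g2 [G2 g20 g2n]] := dG (gam i2) p2.
  have B1 := dT (gam D) p1 (gam i1); have B2 := dT (gam D) p2 (gam i2).
  have B1' := dT (gam D) (gam i1) p1; have B2' := dT (gam D) (gam i2) p2.
  have C1 := dC p1 (gam i1); have C2 := dC p2 (gam i2).
  rewrite (geodesicE Hgam) // in B1; rewrite (geodesicE Hgam) // in B2.
  rewrite (geodesicE Hgam) // in B1'; rewrite (geodesicE Hgam) // in B2'.
  have S1 k : k <= d p1 (gam i1) -> d (gam D) p1 <= d (gam D) (g1 k) + d p1 (gam i1)
      /\ d (gam D) (g1 k) <= d (gam D) p1 + d p1 (gam i1).
    move=> Hk; have E : d p1 (g1 k) = k by rewrite -[in LHS]g10 (geodesicE G1) //; lia.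
    have := dT (gam D) (g1 k) p1; have := dT (gam D) p1 (g1 k); rewrite (dC (g1 k) p1); lia.
  have S2 k : k <= d (gam i2) p2 -> d (gam D) p2 <= d (gam D) (g2 k) + d p2 (gam i2)
      /\ d (gam D) (g2 k) <= d (gam D) p2 + d p2 (gam i2).
    move=> Hk; have E : d p2 (g2 k) = d (gam i2) p2 - k.
      by rewrite -[in LHS]g2n (geodesicE G2) //; lia.
    have := dT (gam D) (g2 k) p2; have := dT (gam D) p2 (g2 k); rewrite (dC (g2 k) p2); lia.
  set lo := minn i1 i2; set hi := maxn i1 i2.
  have cS := segment_connected G1 (leqnn _) (i := 0).
  have cS' := segment_connected G2 (leqnn _) (i := 0).
  have cM : coarsely_connected (segment gam lo hi).
    by apply: (segment_connected Hgam); rewrite /hi; lia.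
  have Ml : segment gam lo hi (gam i1) by exists i1 => //; rewrite /lo /hi; lia.
  have Mr : segment gam lo hi (gam i2) by exists i2 => //; rewrite /lo /hi; lia.
  have e1 : segment g1 0 (d p1 (gam i1)) (gam i1) by exists (d p1 (gam i1)) => //; lia.
  have e2 : segment g2 0 (d (gam i2) p2) (gam i2) by exists 0 => //; lia.
  have c12 := union_connected cS cM e1 Ml.
  have c123 := union_connected c12 cS' (or_intror Mr) e2.
  case: (HS _ c123).
  - move=> v [[]|] [k Hk ->].
    + by have := S1 k; lia.
    + by rewrite (geodesicE Hgam); move: Hk; rewrite /lo /hi; lia.
    + by have := S2 k; lia.
  - by left; left; exists 0 => //; lia.
  - by right; exists (d (gam i2) p2) => //; lia.
  - move=> v [[]|] [k Hk ->].
    + by have := S1 k; lia.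
    + by rewrite (geodesicE Hgam); move: Hk; rewrite /lo /hi; lia.
    + by have := S2 k; lia.
have [i Hi N] := curve_nearest gam D p0.
have A := Hp0 _ Hi.
have [g [G g0 gn]] := dG (gam i) p0.
have C0 := dC p0 (gam i).
(* [p0] branches off near one end of [gam], and [gam 0] is too far from [p0]. *)
have Hi' : D - i < m.
  case: (branch_near_ends Hgam Hi N) => //; first by lia.
  have := dT (gam 0) (gam i) (gam D); have := dT (gam i) p0 (gam D).
  rewrite !(geodesicE Hgam) // (dC p0 (gam D)); have := N D; rewrite (dC p0 (gam D)); lia.
have E1 : d (gam i) (g (5 * m)) = 5 * m by rewrite -[in LHS]g0 (geodesicE G) //; lia.
have E2 : d p0 (g (5 * m)) = d (gam i) p0 - 5 * m.
  by rewrite -[in LHS]gn (geodesicE G) //; lia.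
exists (g (5 * m)); split.
  by move=> j Hj; have := dT p0 (g (5 * m)) (gam j); have := N _ Hj; lia.
have := dT (gam D) (gam i) (g (5 * m)); rewrite (geodesicE Hgam) //; lia.
Qed.

(** * The second arc and its position relative to the first *)

Section SecondArc.

Variables (L : nat) (sig : nat -> X).
Hypothesis Hsig : geodesic d sig L.
Hypothesis Hsig0 : forall j, j <= D -> 5 * m <= d (sig 0) (gam j).
Hypothesis Hsig0' : d (gam D) (sig 0) <= 6 * m.
Hypothesis HsigL : sig L = gam 0.

Let L_le : L <= D.
Proof. by have := HD (sig 0) (sig L); rewrite (geodesicE Hsig) //; lia. Qed.

Let D_le : D <= L + 6 * m.
Proof.
have := dT (gam D) (sig 0) (sig L); rewrite HsigL (geodesicE Hgam) // -HsigL (geodesicE Hsig) //; lia.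
Qed.

Let sig_from_end j : j <= L -> d (sig j) (gam 0) = L - j.
Proof. by move=> Hj; rewrite -HsigL (geodesicE Hsig) //; lia. Qed.

(* The diameter bound forbids the second arc from backtracking past [gam D]. *)
Lemma second_arc_avoids_end j : j <= L -> 5 * m <= (d (sig j) (gam D)).*2.
Proof.
move=> Hj; have := dT (gam 0) (sig j) (gam D); have := dT (sig 0) (sig j) (gam D).
have := Hsig0 (leqnn D); rewrite (geodesicE Hgam) // (dC (gam 0)) sig_from_end //.
rewrite (geodesicE Hsig) //; lia.
Qed.

(** At a step where [sig] comes within [m] of [gam], the nearest point of [gam] lies near an end.
    The end [gam D] is excluded by [second_arc_avoids_end], so it is [gam 0], towards which [sig]
    keeps moving. *)
Lemma second_arc_away j k : j <= L -> k <= D -> d (sig j) (gam k) < m ->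
  d (sig j) (gam 0) <= m.*2.
Proof.
move=> Hj Hk Hjk.
pose P v := forall i, i <= D -> m <= d v (gam i).
have P0 : P (sig 0) by move=> i Hi; have := Hsig0 Hi; lia.
have Pj : ~ P (sig j) by move/(_ _ Hk); lia.
case: (segment_connected Hsig Hj (i := 0) (P := P) (x := sig 0) (y := sig j)) => //.
- by exists 0 => //; lia.
- by exists j => //; lia.
move=> _ [_ [[i1 Hi1 ->] [i2 Hi2 ->] P1 P2 H12]].
have [i Hi N] := curve_nearest gam D (sig i1).
have [k2 Hk2 N2] := curve_nearest gam D (sig i2).
have F2 : d (sig i2) (gam k2) < m.
  rewrite ltnNge; apply/negP => F; apply: P2 => j' Hj'; exact: leq_trans F (N2 _ Hj').
have F1 := dT (sig i1) (sig i2) (gam k2).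
have F3 := N _ Hk2.
case: (branch_near_ends Hgam Hi N (P1 _ Hi)) => H.
  have := dT (sig i1) (gam i) (gam 0); rewrite (geodesicE Hgam) //.
  rewrite !sig_from_end; lia.
have := dT (sig i1) (gam i) (gam D); rewrite (geodesicE Hgam) //.
have := second_arc_avoids_end (j := i1); lia.
Qed.

Lemma second_arc_meets M j k : m <= M -> j <= L -> k <= D -> d (sig j) (gam k) <= M ->
  d (sig j) (gam 0) <= M + m \/ d (sig j) (gam D) <= M + m.
Proof.
move=> HM Hj Hk Hjk.
have [i Hi N] := curve_nearest gam D (sig j).
have F := N _ Hk.
case: (ltnP (d (sig j) (gam i)) m) => H.
  by left; have := second_arc_away Hj Hi H; lia.
case: (branch_near_ends Hgam Hi N H) => Hend; [left|right].
  by have := dT (sig j) (gam i) (gam 0); rewrite (geodesicE Hgam) //; lia.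
by have := dT (sig j) (gam i) (gam D); rewrite (geodesicE Hgam) //; lia.
Qed.

(** A far point [y] could branch off the two arcs only near a common end. There the arcs already
    form two arms, and the geodesic to [y] would complete a tripod. *)
Lemma arcs_cover y : (exists2 i, i <= D & d y (gam i) <= 14 * m) \/
  (exists2 j, j <= L & d y (sig j) <= 14 * m).
Proof.
have [i Hi N1] := curve_nearest gam D y.
have [j Hj N2] := curve_nearest sig L y.
case: (leqP (d y (gam i)) (14 * m)) => F1; first by left; exists i.
case: (leqP (d y (sig j)) (14 * m)) => F2; first by right; exists j.
exfalso.
have M1 : m <= d y (gam i) by lia.
have M2 : m <= d y (sig j) by lia.
have K1 := dC y (gam 0); have K2 := dC y (gam D).
(* The error [m] comes from [branch_near_ends]; at [gam D] it grows to [7 * m] because [sig 0] may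
   be [6 * m] away. *)
have [near0|nearD] : (forall v, (exists2 i, i <= D & v = gam i) \/ (exists2 j, j <= L & v = sig j) ->
    d y (gam 0) <= d y v + m) \/
   (forall v, (exists2 i, i <= D & v = gam i) \/ (exists2 j, j <= L & v = sig j) ->
    d y (gam D) <= d y v + 7 * m).
  case: (leqP (d y (gam i)) (d y (sig j))) => F.
    case: (branch_near_ends Hgam Hi N1 M1) => H.
      left => v Hv; have := dT y (gam i) (gam 0); rewrite (geodesicE Hgam) //.
      by case: Hv => [] [k Hk ->]; [have := N1 _ Hk | have := N2 _ Hk]; lia.
    right => v Hv; have := dT y (gam i) (gam D); rewrite (geodesicE Hgam) //.
    by case: Hv => [] [k Hk ->]; [have := N1 _ Hk | have := N2 _ Hk]; lia.
  case: (branch_near_ends Hsig Hj N2 M2) => H.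
    right => v Hv; have := dT y (sig j) (gam D); have := dT (sig j) (sig 0) (gam D).
    rewrite (geodesicE Hsig) // (dC (sig 0)).
    by case: Hv => [] [k Hk ->]; [have := N1 _ Hk | have := N2 _ Hk]; lia.
  left => v Hv; have := dT y (sig j) (gam 0); rewrite sig_from_end //.
  by case: Hv => [] [k Hk ->]; [have := N1 _ Hk | have := N2 _ Hk]; lia.
- have A0 j' : L - 5 * m <= j' <= L -> forall k, k <= D -> 
      2 * m < L - j' -> b < d (sig j') (gam k).
    move=> Hj' k Hk H; rewrite ltnNge; apply/negP => H'.
    by have := second_arc_away (j := j') (k := k); rewrite sig_from_end; lia.
  suff: d y (gam 0) < 5 * m by have := N1 0; lia.
  apply: (@no_third_branch (gam 0) (segment gam 0 (5 * m)) (segment sig (L - 5 * m) L)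
    (gam (5 * m)) (sig (L - 5 * m)) y (5 * m) (5 * m) m) => //; try lia.
  + by apply: (segment_connected Hgam); lia.
  + by apply: (segment_connected Hsig); lia.
  + by move=> _ [k Hk ->]; rewrite (geodesicE Hgam); lia.
  + by move=> _ [k Hk ->]; rewrite dC sig_from_end; lia.
  + by exists 0.
  + by rewrite -HsigL; exists L => //; lia.
  + by exists (5 * m) => //; lia.
  + by exists (L - 5 * m) => //; lia.
  + move=> _ [k Hk ->]; rewrite dC; case: (ltnP (2 * m) (L - k)) => H; first by apply: A0; lia.
    have := dT (gam (5 * m)) (sig k) (gam 0); rewrite (geodesicE Hgam) ?sig_from_end; try lia.
    by rewrite dC /m; lia.
  + by move=> _ [k Hk ->]; apply: A0; lia.
  + by rewrite (geodesicE Hgam); lia.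
  + by rewrite dC sig_from_end; lia.
  + by move=> _ [k Hk ->]; apply: near0; left; exists k => //; lia.
  + by move=> _ [k Hk ->]; apply: near0; right; exists k => //; lia.
have [g [G g0 gn]] := dG (gam D) (sig 0).
have Dg k : k <= d (gam D) (sig 0) -> d (gam D) (g k) = k.
  by move=> Hk; rewrite -[in LHS]g0 (geodesicE G) //; lia.
have AD k j' : k <= D -> j' <= 14 * m -> b < d (sig j') (gam k).
  move=> Hk Hj'; rewrite ltnNge; apply/negP => H'.
  by have := second_arc_away (j := j') (k := k); rewrite sig_from_end; lia.
have A14 k : k <= d (gam D) (sig 0) -> b < d (gam (D - 14 * m)) (g k).
  by move=> Hk; have := dT (gam D) (g k) (gam (D - 14 * m));
     rewrite Dg // (geodesicE Hgam) /m ?(dC (g k)); lia.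
have As k : k <= 14 * m -> d (gam D) (sig k) <= 6 * m + k /\ k <= d (gam D) (sig k) + 6 * m.
  move=> Hk; have := dT (gam D) (sig 0) (sig k); have := dT (sig 0) (gam D) (sig k).
  by rewrite (geodesicE Hsig) ?(dC (sig 0) (gam D)); lia.
suff: d y (gam D) < 14 * m by have := N1 D; lia.
(* The second arm bridges the gap from [gam D] to [sig 0] and then follows [sig]. Its tip
   [sig (14 * m)] is at least [8 * m] from [gam D], which exceeds [2b] plus the error [7 * m]. *)
apply: (@no_third_branch (gam D) (segment gam (D - 14 * m) D)
  (fun v => segment g 0 (d (gam D) (sig 0)) v \/ segment sig 0 (14 * m) v)
    (gam (D - 14 * m)) (sig (14 * m)) y (14 * m) (8 * m) (7 * m)) => //; try lia.
+ by apply: (segment_connected Hgam); lia.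
+ apply: (@union_connected _ _ (sig 0)).
  * by apply: (segment_connected G); lia.
  * by apply: (segment_connected Hsig); lia.
  * by exists (d (gam D) (sig 0)); [lia | rewrite gn].
  * by exists 0.
+ by move=> _ [k Hk ->]; rewrite (geodesicE Hgam); lia.
+ by move=> _ [] [k Hk ->]; [rewrite Dg | have := As k]; lia.
+ by exists D => //; lia.
+ by left; rewrite -g0; exists 0.
+ by exists (D - 14 * m) => //; lia.
+ by right; exists (14 * m) => //; lia.
+ move=> _ [] [k Hk ->]; first by apply: A14; lia.
  by rewrite dC; apply: AD; lia.
+ by move=> _ [k Hk ->]; apply: AD; lia.
+ by rewrite (geodesicE Hgam); lia.
+ by have := As (14 * m); lia.
+ by move=> _ [k Hk ->]; apply: nearD; left; exists k => //; lia.
+ move=> _ [] [k Hk ->]; last by apply: nearD; right; exists k => //; lia.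
  by have := dT y (g k) (gam D); rewrite (dC (g k)) Dg; lia.
Qed.

Lemma arcs_distance i j : i <= D -> j <= L ->
  [/\ d (gam i) (sig j) <= i + (L - j),
      d (gam i) (sig j) <= (D - i) + j + 6 * m &
      i + (L - j) <= d (gam i) (sig j) + 100 * m \/
      (D - i) + j <= d (gam i) (sig j) + 100 * m].
Proof.
move=> Hi Hj; split.
- by have := dT (gam i) (gam 0) (sig j); rewrite (geodesicE Hgam) // (dC (gam 0)) sig_from_end //; lia.
- have := dT (gam i) (gam D) (sig j); have := dT (gam D) (sig 0) (sig j).
  by rewrite (geodesicE Hgam) // (geodesicE Hsig) //; lia.
(* Where the geodesic leaves the [14 * m]-neighbourhood of [gam], it is near [sig] by [arcs_cover].
   That point of [sig] is within [29 * m] of [gam], hence within [30 * m] of a common end, and the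
   geodesic within [44 * m]. The detour through this end costs twice [44 * m], and up to [6 * m]
   more for the gap at [gam D]. *)
have [v [Hv Hend]] : exists v, d (gam i) v + d v (sig j) = d (gam i) (sig j) /\
    (d v (gam 0) <= 44 * m \/ d v (gam D) <= 44 * m).
  pose P v := exists2 k, k <= D & d v (gam k) <= 14 * m.
  case: (classic (P (sig j))) => Pj.
    exists (sig j); split; first by rewrite dxx addn0.
    case: Pj => k Hk Hk'; have := second_arc_meets (M := 14 * m) _ Hj Hk Hk'; lia.
  have [g [G g0 gn]] := dG (gam i) (sig j).
  have Pi : P (gam i) by exists i => //; rewrite dxx; lia.
  case: (segment_connected G (leqnn _) (i := 0) (P := P) (x := gam i) (y := sig j)) => //.
  - by rewrite -g0; exists 0.
  - by exists (d (gam i) (sig j)); [lia | rewrite gn].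
  move=> u [_ [_ [k Hk ->] [k1 Hk1 Pu] Pv Huv]].
  exists (g k); split.
    by rewrite -[X in d X _ + _]g0 -[X in _ + d _ X]gn !(geodesicE G) //; lia.
  have [/Pv //|[j1 Hj1 Hj1']] := arcs_cover (g k).
  have F1 := dT u (g k) (sig j1).
  have F2 := dT (sig j1) u (gam k1); have F3 := dC (sig j1) u.
  have F4 : d (sig j1) (gam k1) <= 29 * m by lia.
  have F5 := dT (g k) (sig j1) (gam 0); have F6 := dT (g k) (sig j1) (gam D).
  case: (second_arc_meets (M := 29 * m) _ Hj1 Hk1 F4); lia.
have T1 := dT (gam i) v (gam 0); have T2 := dT (gam i) v (gam D).
have T3 := dT (sig j) v (gam 0); have T4 := dT (sig j) v (gam D).
have T5 := dT (sig j) (gam D) (sig 0).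
move: T1 T2 T3 T4 T5; rewrite !(geodesicE Hgam) // sig_from_end // (geodesicE Hsig) //.
rewrite (dC (sig j) v); case: Hend => H; [left|right]; lia.
Qed.
End SecondArc.


Theorem circular_shape : exists (L : nat) (sig : nat -> X),
  [/\ geodesic d sig L, L <= D, D <= L + 6 * m,
      forall y, (exists2 i, i <= D & d y (gam i) <= 14 * m) \/
                (exists2 j, j <= L & d y (sig j) <= 14 * m) &
      forall i j, i <= D -> j <= L ->
        [/\ d (gam i) (sig j) <= i + (L - j),
            d (gam i) (sig j) <= (D - i) + j + 6 * m &
            i + (L - j) <= d (gam i) (sig j) + 100 * m \/
            (D - i) + j <= d (gam i) (sig j) + 100 * m]].
Proof.
have [p [Hp1 Hp2]] := exit_far_end.
have [sig [Hs s0 sL]] := dG p (gam 0).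
have S0 : forall j, j <= D -> 5 * m <= d (sig 0) (gam j) by rewrite s0.
have S1 : d (gam D) (sig 0) <= 6 * m by rewrite s0.
exists (d p (gam 0)), sig; split => //.
- have := dT (gam D) p (gam 0); rewrite (geodesicE Hgam) //; lia.
- exact: (arcs_cover Hs S0 S1 sL).
- exact: (arcs_distance Hs S0 S1 sL).
Qed.

End Global.
End PathMetric.

(** * Propagating a line-like ball *)

(** The lower bound is multiplied by [C] so that it can be stated in the natural numbers. *)
Definition nat_quasi_isometry (X : Type) (d : X -> X -> nat) (C K : nat) (f : X -> X) :=
  [/\ forall x y, d x y <= C * (d (f x) (f y) + K),
      forall x y, d (f x) (f y) <= C * d x y + K &
      forall y, exists x, d y (f x) <= K].

Section Charts.

Variables (X : finType) (d : X -> X -> nat).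
Hypothesis Hd : path_metric d.

Let dxx : forall x, d x x = 0. Proof. by case: Hd. Qed.
Let dC : forall x y, d x y = d y x. Proof. by case: Hd. Qed.
Let dT : forall x y z, d x z <= d x y + d y z. Proof. by case: Hd. Qed.

(** * Coarse coordinates along a line *)

Section Chart.

Variables (q : X) (rho J b : nat) (t : X -> nat).
Hypothesis tJ : forall p p', d q p <= rho -> d q p' <= rho -> d p p' <= 1 ->
  t p <= t p' + J.
Hypothesis tb : forall p p', d q p <= rho -> d q p' <= rho ->
  t p <= t p' + J -> t p' <= t p + J -> d p p' <= b.

(** A discrete intermediate value theorem: [t] jumps by at most [J] along [S], so some point of [S]
    has a value within [J] of [t x]. *)
Lemma chart_crossing S p p' x : coarsely_connected d S -> in_ball d q rho S ->
  S p -> S p' -> d q x <= rho -> t p <= t x <= t p' -> exists2 v, S v & d x v <= b.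
Proof.
move=> cS BS Sp Sp' Bx /andP[H1 H2].
case: (leqP (t p') (t x)) => H3; first by exists p' => //; apply: (tb Bx (BS _ Sp')); lia.
case: (cS (fun v => t v <= t x) p p') => //; first by apply/negP; lia.
move=> u [v [Su Sv Pu /negP Pv Huv]]; exists u => //.
have Hvu : d v u <= 1 by rewrite dC.
by have := tJ (BS _ Sv) (BS _ Su) Hvu; move=> Huv'; apply: (tb Bx (BS _ Su)); lia.
Qed.

(** Two of the three tips lie on the same side of [t q]. The arm of the outer one crosses the value
    of the other and so comes within [b] of that tip. *)
Lemma chart_tripod_free : tripod_free d rho b q.
Proof.
move=> S1 S2 S3 a1 a2 a3 c1 c2 c3 B1 B2 B3 q1 q2 q3 h1 h2 h3 f12 f13 f21 f23 f31 f32.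
have same_side S S' a a' : coarsely_connected d S -> coarsely_connected d S' ->
    in_ball d q rho S -> in_ball d q rho S' -> S q -> S' q -> S a -> S' a' ->
    far_from d b a S' -> far_from d b a' S ->
    ~ (t q <= t a /\ t q <= t a') /\ ~ (t a <= t q /\ t a' <= t q).
  move=> cS cS' BS BS' Sq S'q Sa S'a' far far'; split=> -[Ha Ha'].
    case: (leqP (t a) (t a')) => H.
      case: (chart_crossing cS' BS' S'q S'a' (BS _ Sa)) => [|v Sv]; first by rewrite Ha.
      by have := far _ Sv; lia.
    case: (chart_crossing cS BS Sq Sa (BS' _ S'a')) => [|v Sv]; first by rewrite Ha'; lia.
    by have := far' _ Sv; lia.
  case: (leqP (t a) (t a')) => H.
    case: (chart_crossing cS BS Sa Sq (BS' _ S'a')) => [|v Sv]; first by rewrite Ha'; lia.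
    by have := far' _ Sv; lia.
  case: (chart_crossing cS' BS' S'a' S'q (BS _ Sa)) => [|v Sv]; first by rewrite Ha; lia.
  by have := far _ Sv; lia.
have [] := same_side S1 S2 a1 a2; try done.
have [] := same_side S1 S3 a1 a3; try done.
have [] := same_side S2 S3 a2 a3; try done.
lia.
Qed.

End Chart.

(** * Transfer of a thin ball by a quasi-isometry *)

Definition thin r r' (g : nat -> X) := geodesic d g r'.*2 /\
  forall w, d (g r') w <= r' -> exists2 i, i <= r'.*2 & d w (g i) <= 3 * r.

Variables (C K r r' h rho : nat) (g : nat -> X).
Hypothesis C_gt0 : 0 < C.
Hypothesis r_large : C * (1 + 3 * K) + 3 * K <= r.
Hypothesis r'_large : C * (rho + 2 * K) <= r'.
Hypothesis h_large : 8 * r <= C * (h + K).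
Hypothesis h_small : C * (h + K) <= r'.
Hypothesis rho_large : C * (C * (h + K)) + K <= rho.
Hypothesis g_thin : thin r r' g.

(** A point near [y] is close to the image of a point near [g]; its position on [g] is a chart
    around [y]. The images of two points of [g] on either side of the midpoint show that [y] is no
    dead end. *)
Lemma thin_transfer y f : nat_quasi_isometry d C K f -> f (g r') = y ->
  tripod_free d rho (14 * C * r) y /\
  two_sided d rho (14 * C * r) h (C * (C * (h + K)) + K) y.
Proof.
move=> [f1 f2 f3] fy; have [Hg Hthin] := g_thin.
have CK : C * (2 * K) <= r by rewrite -(leq_add2r (C * (1 + K))) -mulnDr; lia.
have mulC m n : m <= n -> C * m <= C * n by rewrite leq_pmul2l.
(* By [r'_large] a coarse preimage of [p] lies in the ball captured by [g]. Outside the [rho]-ball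
   around [y] the index is the dummy [0]. *)
have /fin_all_exists[t Ht] : forall p, exists i, d y p <= rho ->
    i <= r'.*2 /\ exists2 a, d p (f a) <= K & d a (g i) <= 3 * r.
  move=> p.
  have [a Ha] := f3 p.
  case: (leqP (d y p) rho) => Hp; last by exists 0.
  have B := dT y p (f a).
  have D1 := f1 (g r') a; rewrite fy in D1.
  have D2 := mulC (d y (f a) + K) (rho + 2 * K).
  by have [|i Hi Hi'] := Hthin a; [lia | exists i => _; split=> //; exists a].
(* Coarse preimages of neighbours are within [C * (1 + 3 * K) <= r], and each projection to [g] adds
   [3 * r]. *)
have tJ p p' : d y p <= rho -> d y p' <= rho -> d p p' <= 1 -> t p <= t p' + 7 * r.
  move=> Hp Hp' Hpp'; have [T [a A1 A2]] := Ht _ Hp; have [T' [a' A1' A2']] := Ht _ Hp'.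
  have := dT (f a) p (f a'); have := dT p p' (f a'); rewrite (dC (f a) p) => E1 E2.
  have E3 := f1 a a'; have E4 := mulC (d (f a) (f a') + K) (1 + 3 * K).
  have := dT (g (t p)) a (g (t p')); have := dT a a' (g (t p')).
  by rewrite (geodesicE Hd Hg) // (dC (g (t p)) a); lia.
have tb p p' : d y p <= rho -> d y p' <= rho -> t p <= t p' + 7 * r ->
    t p' <= t p + 7 * r -> d p p' <= 14 * C * r.
  move=> Hp Hp' H H'; have [T [a A1 A2]] := Ht _ Hp; have [T' [a' A1' A2']] := Ht _ Hp'.
  have := dT a (g (t p)) a'; have := dT (g (t p)) (g (t p')) a'.
  rewrite (geodesicE Hd Hg) // (dC (g (t p')) a') => E1 E2.
  have E3 := f2 a a'; have E4 := mulC (d a a') (13 * r).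
  have := dT p (f a) p'; have := dT (f a) (f a') p'; rewrite (dC (f a') p').
  have : r <= C * r by rewrite leq_pmull.
  by have := mulnA C 13 r; have := mulnC C 13; have := mulnA 14 C r; lia.
split; first exact: chart_tripod_free tJ tb.
(* [s] is a distance that [f] cannot shrink below [h]. *)
set s := C * (h + K).
have s_ge : 8 * r <= s := h_large.
have s_le : s <= r' := h_small.
have s_rho : C * s + K <= rho := rho_large.
have far i : i <= r'.*2 -> i + s = r' \/ i = r' + s ->
    h <= d y (f (g i)) /\ d y (f (g i)) <= C * s + K.
  move=> Hi His; have E : d (g r') (g i) = s by rewrite (geodesicE Hd Hg) //; lia.
  split; last by rewrite -fy -E; apply: f2.
  have := f1 (g r') (g i); rewrite E fy /s leq_pmul2l //; lia.
have pos i : i <= r'.*2 -> d y (f (g i)) <= rho ->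
    t (f (g i)) <= i + 4 * r /\ i <= t (f (g i)) + 4 * r.
  move=> Hi Hy; have [T [a A1 A2]] := Ht _ Hy.
  have E1 := f1 (g i) a; have E2 := mulC (d (f (g i)) (f a) + K) (2 * K).
  have := dT (g i) a (g (t (f (g i)))); rewrite (geodesicE Hd Hg) //; lia.
have L1 : r' + s <= r'.*2 by lia.
have L2 : r' - s <= r'.*2 by lia.
have [F1 F1'] := far _ L1 (or_intror erefl).
have [F2 F2'] : h <= d y (f (g (r' - s))) /\ d y (f (g (r' - s))) <= C * s + K.
  by apply: far => //; left; lia.
exists (f (g (r' + s))), (f (g (r' - s))); split=> //.
move=> S cS BS S1 S2.
apply: (chart_crossing tJ tb cS BS S2 S1); first by rewrite dxx.
(* The chart errs by at most [4 * r] at each of the three points and [8 * r <= s], so the value at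
   [y] lies between the other two. *)
have P0 := pos r'; rewrite fy dxx in P0.
have P1 := pos _ L1 (leq_trans F1' s_rho).
have P2 := pos _ L2 (leq_trans F2' s_rho).
lia.
Qed.

End Charts.

(** * Growth *)

Section Growth.

Variables (X : finType) (d : X -> X -> nat).
Hypothesis Hd : path_metric d.

Let dxx : forall x, d x x = 0. Proof. by case: Hd. Qed.
Let dC : forall x y, d x y = d y x. Proof. by case: Hd. Qed.
Let dT : forall x y z, d x z <= d x y + d y z. Proof. by case: Hd. Qed.

Definition ball c r : {set X} := [set x | d c x <= r].

Lemma packing r N (A : {set X}) (s : seq X) :
  pairwise (fun x y => r.*2 < d x y) s ->
  {in s, forall c, N <= #|ball c r| /\ ball c r \subset A} -> size s * N <= #|A|.
Proof.
elim: s A => [|c s IH] A //= /andP[/allP Hc Hs] HA.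
have [c1 c2] := HA c (mem_head _ _).
have := IH (A :\: ball c r) Hs.
have -> : #|A :\: ball c r| = #|A| - #|ball c r| by rewrite cardsD (setIidPr c2).
have := subset_leq_card c2 => Hle H.
suff: size s * N <= #|A| - #|ball c r| by rewrite mulSn; lia.
apply: H => c' Hc'; have [? ?] : N <= #|ball c' r| /\ ball c' r \subset A by apply: HA; rewrite inE Hc' orbT.
split=> //; rewrite subsetD; apply/andP; split=> //.
rewrite disjoint_subset; apply/subsetP => x; rewrite !inE => Hx; apply/negP => Hx'.
have := Hc _ Hc'; have := dT c x c'; rewrite (dC x); lia.
Qed.

(** * Scales and blocks along a geodesic *)

Variables (Q r0 : nat).

(** The summand [Q] makes the vertex count [2 * scale k + 1] of a block grow by exactly the factor
    [2Q+1], so that a block splits evenly into smaller ones. *)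
Fixpoint scale k := if k is k.+1 then Q.*2.+1 * scale k + Q else r0.

Lemma scaleE k : (scale k).*2.+1 = Q.*2.+1 ^ k * r0.*2.+1.
Proof. by elim: k => [|k IH]; rewrite ?expnS /=; [lia | rewrite -mulnA -IH; lia]. Qed.

Lemma blocks_pairwise g n r k : geodesic d g n -> k * r.*2.+1 <= n.+1 ->
  pairwise (fun x y => r.*2 < d x y) [seq g (r + i * r.*2.+1) | i <- iota 0 k].
Proof.
move=> Hg Hk; rewrite pairwise_map.
apply: (@sub_in_pairwise _ (fun i => i < k) ltn).
- move=> i j Hi Hj /= Hij.
  move: Hi Hj; rewrite !unfold_in /= => Hi Hj.
  have := leq_mul (Hij : i.+1 <= j) (leqnn r.*2.+1).
  have := leq_mul (Hj : j.+1 <= k) (leqnn r.*2.+1); rewrite !mulSn => E1 E2.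
  rewrite (geodesicE Hd Hg); lia.
- by apply/allP => i; rewrite mem_iota.
by rewrite -sorted_pairwise; [exact: iota_ltn_sorted | exact: ltn_trans].
Qed.

(* The [2Q+1] disjoint sub-blocks of a geodesic, together with one block that leaves it. *)
Lemma ball_growth k g : (forall i, i < k -> forall g', ~ thin d (scale i) (scale i.+1) g') ->
  geodesic d g (scale k).*2 -> Q.*2.+2 ^ k <= #|ball (g (scale k)) (scale k)|.
Proof.
elim: k g => [|k IH] g Hthin Hg.
  by rewrite expn0 card_gt0; apply/set0Pn; exists (g (scale 0)); rewrite inE dxx.
set r := scale k in IH *; set R := scale k.+1 in Hg *.
have HR : R = Q.*2.+1 * r + Q by [].
have HR2 : R.*2.+1 = Q.*2.+1 * r.*2.+1 by rewrite HR; lia.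
have [w [Hw1 Hw2]] : exists w, d (g R) w <= R /\ forall i, i <= R.*2 -> 3 * r < d w (g i).
  apply: NNPP => Hno; apply: (Hthin k (leqnn _) g); split=> // w Hw.
  apply: NNPP => Hno'; apply: Hno; exists w; split=> // i Hi.
  by rewrite ltnNge; apply/negP => Hi'; apply: Hno'; exists i.
have [_ _ _ dG] := Hd.
(* The extra block is the start of the geodesic from [w] to the centre. Its midpoint is [r] from
   [w], hence more than [2 * r] from every point of [g]. *)
have [g' [Hg' g'0 g'n]] := dG w (g R).
have Hlen : 3 * r < d w (g R) by apply: Hw2; lia.
have W1 : d w (g' r) = r by rewrite -[in LHS]g'0 (geodesicE Hd Hg') //; lia.
have W2 : d (g R) (g' r) = d w (g R) - r by rewrite -[in LHS]g'n (geodesicE Hd Hg') //; lia.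
pose s := g' r :: [seq g (r + i * r.*2.+1) | i <- iota 0 Q.*2.+1].
have idx i : i < Q.*2.+1 -> r + i * r.*2.+1 + r <= R.*2.
  move=> Hi; have := leq_mul (Hi : i.+1 <= _) (leqnn r.*2.+1); rewrite -HR2 mulSn; lia.
suff: size s * (Q.*2.+2 ^ k) <= #|ball (g R) R| by rewrite /= size_map size_iota expnS.
have IH' := fun g => IH g (fun i Hi => Hthin i (ltnW Hi)).
apply: (@packing r).
  rewrite pairwise_cons; apply/andP; split; last first.
    by apply: (blocks_pairwise Hg); rewrite HR2.
  apply/allP => x /mapP[i]; rewrite mem_iota add0n => Hi ->.
  have := Hw2 (r + i * r.*2.+1); have := dT w (g' r) (g (r + i * r.*2.+1)).
  by have := idx _ Hi; lia.
move=> c; rewrite inE => /orP[/eqP->|/mapP[i]].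
  split.
    by apply: IH' => i j Hi Hj; apply: Hg'; lia.
  apply/subsetP => x; rewrite !inE => Hx; have := dT (g R) (g' r) x; rewrite (dC w) in Hw1 Hlen W2 *.
  lia.
rewrite mem_iota add0n => Hi ->; have Hidx := idx _ Hi; split.
  pose gi j := g (i * r.*2.+1 + j).
  rewrite addnC -/(gi r); apply: IH' => j1 j2 H1 H2.
  by rewrite /gi (geodesicE Hd Hg); lia.
apply/subsetP => x; rewrite !inE => Hx.
have := dT (g R) (g (r + i * r.*2.+1)) x; rewrite (geodesicE Hd Hg); lia.
Qed.

Lemma order_growth k D g : (forall i, i < k -> forall g', ~ thin d (scale i) (scale i.+1) g') ->
  geodesic d g D -> D.+1 %/ (scale k).*2.+1 * Q.*2.+2 ^ k <= #|X|.
Proof.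
move=> Hthin Hg; set r := scale k; set n := _ %/ _.
have Hn : n * r.*2.+1 <= D.+1 by exact: leq_trunc_div.
rewrite -cardsT -[n in n * _](size_iota 0) -(size_map (fun i => g (r + i * r.*2.+1))).
apply: (@packing r); first exact: blocks_pairwise Hn.
move=> c /mapP[i]; rewrite mem_iota /= add0n => Hi ->; split; last exact: subsetT.
have := leq_mul (Hi : i.+1 <= n) (leqnn r.*2.+1); rewrite mulSn => Hidx.
pose gi j := g (i * r.*2.+1 + j).
rewrite addnC -/(gi r); apply: ball_growth => // j1 j2 H1 H2.
by rewrite /gi (geodesicE Hd Hg); lia.
Qed.

End Growth.

(** * Graphs and Gromov-Hausdorff distance *)

Section GraphDistance.

Variables (T : finType) (e : rel T).
Hypotheses (e_simple : simple_graph e) (e_connected : graph_connected e).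

Let d := gdist e.

Lemma gdist_le_path x p : path e x p -> d x (last x p) <= size p.
Proof.
move=> Hp; case: (ltnP (size p) #|T|) => Hs; last first.
  by apply: leq_trans Hs; rewrite -[X in _ <= X](size_iota 0) /d /gdist find_size.
rewrite leqNgt; apply/negP => H.
have /negbT/negP := before_find 0 H; apply.
rewrite nth_iota // add0n /walkb; apply/existsP.
by exists (in_tuple p); rewrite Hp /=.
Qed.

Lemma gdist_path x y : exists p, [/\ path e x p, last x p = y & size p = d x y].
Proof.
have Hhas : has (walkb e x y) (iota 0 #|T|).
  have /connectP[p Hp Ey] := e_connected x y.
  (* A walk without repeated vertices has fewer than [#|T|] steps, so the bounded search
     succeeds. *)
  case/shortenP: Hp Ey => p' Hp' Up' _ Ey.
  apply/hasP; exists (size p').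
    rewrite mem_iota /= add0n.
    by have := card_uniqP Up' => /= <-; exact: max_card.
  by apply/existsP; exists (in_tuple p'); rewrite Hp' /= Ey.
have := nth_find 0 Hhas; rewrite nth_iota -?has_find ?add0n; last first.
  by rewrite -[X in _ < X](size_iota 0) -has_find.
by rewrite /walkb => /existsP[p /andP[Hp /eqP Hl]]; exists p; rewrite size_tuple.
Qed.

Lemma gdist_path_metric : path_metric d.
Proof.
have [e_sym _] := e_simple.
have dxx x : d x x = 0.
  by apply/eqP; rewrite -leqn0; apply: (@gdist_le_path x [::]).
have dle x y : d y x <= d x y.
  have [p [Hp <- <-]] := gdist_path x y.
  have := @gdist_le_path (last x p) (rev (belast x p)).
  rewrite rev_path size_rev size_belast => H.
  have E : last (last x p) (rev (belast x p)) = x.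
    by case: (p) => //= z p'; rewrite rev_cons last_rcons.
  by rewrite E in H; apply: H; rewrite (eq_path (e' := e)) // => u v; rewrite e_sym.
have dT x y z : d x z <= d x y + d y z.
  have [p [Hp Hl <-]] := gdist_path x y; have [p' [Hp' Hl' <-]] := gdist_path y z.
  rewrite -size_cat -Hl' -Hl -last_cat; apply: gdist_le_path.
  by rewrite cat_path Hp Hl.
split=> // [x y|x y]; first by apply/eqP; rewrite eqn_leq !dle.
have [p [Hp Hl Hs]] := gdist_path x y.
pose g := nth x (x :: p).
have gn : g (d x y) = y by rewrite -Hs /g nth_last.
exists g; split=> //.
have step i : i < size p -> d (g i) (g i.+1) <= 1.
  move=> Hi; have := @gdist_le_path (g i) [:: g i.+1]; apply.
  by rewrite /= andbT; exact: (pathP x Hp).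
have upper i j : i <= j -> j <= size p -> d (g i) (g j) <= j - i.
  move=> Hij; rewrite -(subnKC Hij) addKn; elim: (j - i) => [|k IH] Hk.
    by rewrite addn0 dxx.
  have := dT (g i) (g (i + k)) (g (i + k).+1); have := step (i + k).
  by rewrite addnS in Hk *; have := IH (ltnW Hk); lia.
(* Every partial distance is at most the number of steps and the total attains it, so the triangle
   inequality forces equality throughout. *)
move=> i j Hij Hj; rewrite -Hs in Hj gn *.
have := upper 0 i; have := upper i j; have := upper j (size p).
have := dT (g 0) (g i) (g (size p)); have := dT (g i) (g j) (g (size p)).
have : d (g 0) (g (size p)) = size p by rewrite gn.
lia.
Qed.

Lemma gdist0 x y : d x y = 0 -> x = y.
Proof. by have [[|z p] [_ <- <-]] := gdist_path x y. Qed.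

Lemma gdist_le_gdiam x y : d x y <= gdiam e.
Proof.
by rewrite /gdiam (leq_trans (leq_bigmax y)) // (leq_bigmax (F := fun x => \max_y gdist e x y) x).
Qed.

Lemma gdiam_attained : 0 < #|T| -> exists x y, d x y = gdiam e.
Proof.
move=> H; have [x Hx] := eq_bigmax (fun x => \max_y gdist e x y) H.
by have [y Hy] := eq_bigmax (fun y => gdist e x y) H; exists x, y; rewrite /gdiam Hx Hy.
Qed.

End GraphDistance.

Local Open Scope R_scope.

Lemma INR_leq (m n : nat) : (m <= n)%N -> INR m <= INR n.
Proof. by move/leP; exact: le_INR. Qed.

Lemma leq_INR (m n : nat) : INR m <= INR n -> (m <= n)%N.
Proof. by move/INR_le/leP. Qed.

Lemma INR_addn (m n : nat) : INR (m + n)%N = INR m + INR n.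
Proof. exact: plus_INR. Qed.

Lemma INR_muln (m n : nat) : INR (m * n)%N = INR m * INR n.
Proof. exact: mult_INR. Qed.

(** * Gromov-Hausdorff distance from a correspondence *)

Section Gluing.

Variables (X : finType) (dX : X -> X -> R) (Y : Type) (dY : Y -> Y -> R).
Variables (corr : X -> Y -> Prop) (eta : R).
Hypotheses (mX : is_metric dX) (mY : is_metric dY) (eta_gt0 : 0 < eta).
Hypothesis corr_total : forall x, exists y, corr x y.
Hypothesis corr_onto : forall y, exists x, corr x y.
Hypothesis corr_distortion : forall x x' y y', corr x y -> corr x' y' ->
  Rabs (dX x x' - dY y y') <= eta.

Lemma min_over_seq (F : X -> R) x0 s :
  let m := foldr (fun x m => Rmin (F x) m) (F x0) s in
  (forall x, x \in s -> m <= F x) /\ exists x, m = F x.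
Proof.
elim: s => [|x s [IH1 [x1 IH2]]] /=; first by split=> //; exists x0.
set m := foldr _ _ _ in IH1 IH2 *.
split; last by rewrite /Rmin; case: Rle_dec => _; [exists x | exists x1].
move=> z; rewrite inE => /orP[/eqP->|Hz]; first exact: Rmin_l.
by apply: Rle_trans (IH1 _ Hz); exact: Rmin_r.
Qed.

Theorem GH_lt_of_correspondence eps : 3 / 2 * eta < eps -> inhabited X -> GH_lt dX dY eps.
Proof.
move=> Heps [x0].
have [phi Hphi] := fin_all_exists corr_total.
(* A route from [x] to [y] that changes copies at [x']. Each change costs [eta / 2], so going over
   and back costs [eta], which pays for the distortion in the triangle inequality; it also keeps the
   copies apart. *)
pose F x y x' := dX x x' + dY (phi x') y + eta / 2.
pose c x y := foldr (fun x' m => Rmin (F x y x') m) (F x y x0) (enum X).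
have cle x y x' : c x y <= F x y x'.
  by have [H _] := min_over_seq (F x y) x0 (enum X); apply: H; rewrite mem_enum.
have cex x y : exists x', c x y = F x y x'.
  by have [_ H] := min_over_seq (F x y) x0 (enum X).
have distort x x' : dX x x' - eta <= dY (phi x) (phi x') <= dX x x' + eta.
  have H := corr_distortion (Hphi x) (Hphi x'); move: H; rewrite /Rabs; case: Rcase_abs; lra.
have X0 x x' : 0 <= dX x x' by have [] := mX x x' x.
have Xd x : dX x x = 0 by have [_ [[_ H] _]] := mX x x x; exact: H.
have Yd y : dY y y = 0 by have [_ [[_ H] _]] := mY y y y; exact: H.
have XC x x' : dX x x' = dX x' x by have [_ [_ []]] := mX x x' x.
have XT x y z : dX x z <= dX x y + dX y z by have [_ [_ []]] := mX x y z.
have Y0 x x' : 0 <= dY x x' by have [] := mY x x' x.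
have YC x x' : dY x x' = dY x' x by have [_ [_ []]] := mY x x' x.
have YT x y z : dY x z <= dY x y + dY y z by have [_ [_ []]] := mY x y z.
have c_gt0 x y : 0 < c x y.
  by have [x' ->] := cex x y; have := X0 x x'; have := Y0 (phi x') y; rewrite /F; lra.
have cXX x x' y : c x y <= dX x x' + c x' y.
  have [x1 ->] := cex x' y; apply: Rle_trans (cle _ _ x1) _; have := XT x x' x1; rewrite /F; lra.
have cYY x y y' : c x y <= c x y' + dY y' y.
  have [x1 ->] := cex x y'; apply: Rle_trans (cle _ _ x1) _; have := YT (phi x1) y' y; rewrite /F; lra.
have XXc x x' y : dX x x' <= c x y + c x' y.
  have [x1 ->] := cex x y; have [x2 ->] := cex x' y.
  have := XT x x1 x'; have := XT x1 x2 x'; have := distort x1 x2; have := YT (phi x1) y (phi x2).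
  by rewrite (YC y (phi x2)) (XC x2 x') /F; lra.
have YYc x y y' : dY y y' <= c x y + c x y'.
  have [x1 ->] := cex x y; have [x2 ->] := cex x y'.
  have := YT y (phi x1) y'; have := YT (phi x1) (phi x2) y'; have := distort x1 x2.
  by have := XT x1 x x2; rewrite (YC y (phi x1)) (XC x1 x) /F; lra.
pose dZ (u v : X + Y) := match u, v with
  | inl x, inl x' => dX x x' | inr y, inr y' => dY y y'
  | inl x, inr y => c x y | inr y, inl x => c x y end.
exists (X + Y)%type, dZ, inl, inr; split; last split=> //; last split=> //.
  move=> u v w; split; first by case: u v => [x|y] [x'|y'] //=; exact: Rlt_le.
  split.
    have [H1 H2] : (forall x x' , dX x x' = 0 <-> x = x') /\ (forall y y', dY y y' = 0 <-> y = y').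
      by split=> a a'; [have [_ []] := mX a a' a | have [_ []] := mY a a' a].
    case: u v => [x|y] [x'|y'] /=; split => //.
    - by move/H1 => ->.
    - by case=> /H1.
    - by have := c_gt0 x y'; lra.
    - by have := c_gt0 x' y; lra.
    - by move/H2 => ->.
    - by case=> /H2.
  split; first by case: u v => [x|y] [x'|y'] //=.
  case: u v w => [x|y] [x'|y'] [x''|y''] //=.
  - by have := cXX x'' x' y; rewrite XC; lra.
  - by have := cYY x'' y y'; rewrite (YC y y'); lra.
(* For [y] related to [x], the distortion gives [dY (phi x) y <= eta]; changing copies adds
   [eta / 2]. *)
exists (3 / 2 * eta); split=> //; split=> [x|y] /=.
  exists (phi x); apply: Rle_trans (cle _ _ x) _; rewrite /F.
  by rewrite Xd Yd; lra.
have [x Hx] := corr_onto y; exists x; apply: Rle_trans (cle _ _ x) _; rewrite /F.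
have := corr_distortion (Hphi x) Hx.
by rewrite Xd /Rabs; case: Rcase_abs; lra.
Qed.

End Gluing.

Lemma circle_is_metric : is_metric circle_dist.
Proof.
move=> [x Hx] [y Hy] [z Hz]; rewrite /circle_dist /=.
split; [|split; [|split]].
- by rewrite /Rmin /Rabs; repeat (case: Rcase_abs || case: Rle_dec); lra.
- split=> [H|[->]]; last first.
    by rewrite Rminus_diag Rabs_R0 Rmin_left; lra.
  have E : x = y.
    by move: H; rewrite /Rmin /Rabs; repeat (case: Rcase_abs || case: Rle_dec); lra.
  by subst y; congr exist; exact: proof_irrelevance.
- by rewrite Rabs_minus_sym.
- by rewrite /Rmin /Rabs; repeat (case: Rcase_abs || case: Rle_dec); lra.
Qed.

Lemma nat_floor (n : nat) x : 0 <= x <= INR n ->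
  exists i : nat, (i <= n)%N /\ INR i <= x <= INR i + 1.
Proof.
elim: n => [|n IH] Hx; first by exists 0%N; split=> //=; move: Hx; rewrite /=; lra.
rewrite S_INR in Hx; case: (Rle_lt_dec x (INR n)) => H.
  by have [|i [Hi Hi']] := IH; [lra | exists i; split=> //; lia].
by exists n; split; [lia | lra].
Qed.

(** * The correspondence between two arcs and the circle *)

Section Correspondence.

Variables (X : finType) (d : X -> X -> nat) (D L m : nat) (gam sig : nat -> X).
Hypothesis Hd : path_metric d.
Hypothesis d0 : forall x y, d x y = 0%N -> x = y.
Hypothesis D_gt0 : (0 < D)%N.
Hypothesis m_gt0 : (0 < m)%N.
Hypothesis Hgam : geodesic d gam D.
Hypothesis Hsig : geodesic d sig L.
Hypothesis L_le : (L <= D)%N.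
Hypothesis D_le : (D <= L + 6 * m)%N.
Hypothesis cover : forall y, (exists2 i, (i <= D)%N & (d y (gam i) <= 14 * m)%N) \/
  (exists2 j, (j <= L)%N & (d y (sig j) <= 14 * m)%N).
Hypothesis cross : forall i j, (i <= D)%N -> (j <= L)%N ->
  [/\ (d (gam i) (sig j) <= i + (L - j))%N,
      (d (gam i) (sig j) <= (D - i) + j + 6 * m)%N &
      (i + (L - j) <= d (gam i) (sig j) + 100 * m)%N \/
      ((D - i) + j <= d (gam i) (sig j) + 100 * m)%N].

Let dxx : forall x, d x x = 0%N. Proof. by case: Hd. Qed.
Let dC : forall x y, d x y = d y x. Proof. by case: Hd. Qed.
Let dT : forall x y z, (d x z <= d x y + d y z)%N. Proof. by case: Hd. Qed.

Let delta := INR D.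
Let mu := INR m.
Let dR x y := INR (d x y) / delta.

Let delta_ge1 : 1 <= delta.
Proof. by have := INR_leq D_gt0. Qed.

Let mu_ge1 : 1 <= mu.
Proof. by have := INR_leq m_gt0. Qed.

(** Scaled by [delta], the circle carries [gam] on the arc from [0] to [D] and [sig] from [D] on.
    The slack [7 * mu] allows for [sig] being up to [6 * m] shorter than [D] and for rounding. *)
Let corr x (s : circle) :=
  (exists i, [/\ (i <= D)%N, (d x (gam i) <= 14 * m)%N &
     Rabs (proj1_sig s * delta - INR i) <= 7 * mu]) \/
  (exists j, [/\ (j <= L)%N, (d x (sig j) <= 14 * m)%N &
     Rabs (proj1_sig s * delta - (delta + INR j)) <= 7 * mu]).

Let corr_total x : exists s, corr x s.
Proof.
have divK a : a / delta * delta = a by field; lra.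
have div_le a b : a <= b * delta -> a / delta <= b.
  by move=> H; apply: (Rmult_le_reg_r delta); rewrite ?divK; lra.
have le_div a b : b * delta <= a -> b <= a / delta.
  by move=> H; apply: (Rmult_le_reg_r delta); rewrite ?divK; lra.
case: (cover x) => [[i Hi Hx]|[j Hj Hx]].
  have Hi' := INR_leq Hi; have Hi0 := pos_INR i.
  have s_in : 0 <= INR i / delta < 2.
    split; first by apply: le_div; lra.
    by apply: (Rle_lt_trans _ 1); [apply: div_le; rewrite -/delta in Hi' *; lra | lra].
  exists (exist (fun t => 0 <= t < 2) _ s_in); left; exists i; split=> //=.
  by rewrite divK Rminus_diag Rabs_R0; lra.
have Hj0 := pos_INR j; have Hj' : INR j <= delta by apply: INR_leq; lia.
(* The parameter [2] is not a point of the circle; capping costs at most [1]. *)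
pose a := Rmin (delta + INR j) (2 * delta - 1).
have Ha : delta <= a <= 2 * delta - 1 /\ delta + INR j - 1 <= a <= delta + INR j.
  by rewrite /a /Rmin; case: Rle_dec; lra.
have s_in : 0 <= a / delta < 2.
  split; first by apply: le_div; lra.
  by apply: (Rmult_lt_reg_r delta); rewrite ?divK; lra.
exists (exist (fun t => 0 <= t < 2) _ s_in); right; exists j; split=> //=.
by rewrite divK /Rabs; case: Rcase_abs; lra.
Qed.

Let corr_onto s : exists x, corr x s.
Proof.
case: s => s Hs; case: (Rle_lt_dec s 1) => H1.
  have [|i [Hi Hi']] := @nat_floor D (s * delta).
    rewrite -/delta; have := Rmult_le_compat_r delta s 1; have := Rmult_le_pos s delta; lra.
  exists (gam i); left; exists i; split=> //=; first by rewrite dxx.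
  by rewrite /Rabs; case: Rcase_abs; lra.
have [|n [Hn Hn']] := @nat_floor D ((s - 1) * delta).
  rewrite -/delta; have := Rmult_le_compat_r delta (s - 1) 1.
  have := Rmult_le_pos (s - 1) delta; lra.
exists (sig (minn n L)); right; exists (minn n L); split=> /=; [lia | by rewrite dxx |].
have E1 : INR (minn n L) <= INR n by apply: INR_leq; lia.
have E2 : INR n <= INR (minn n L) + 6 * mu.
  have -> : 6 * mu = INR (6 * m)%N by rewrite INR_muln -/mu /=; lra.
  by rewrite -INR_addn; apply: INR_leq; lia.
by rewrite /Rabs; case: Rcase_abs; lra.
Qed.

Let near_bound c x x' u u' : (d x u <= 14 * m)%N -> (d x' u' <= 14 * m)%N ->
  Rabs (INR (d u u') - c) <= 120 * mu -> Rabs (INR (d x x') - c) <= 148 * mu.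
Proof.
move=> Hx Hx'.
have U1 := dT x u x'; have U2 := dT u u' x'; have U3 := dT u x u'; have U4 := dT x x' u'.
rewrite (dC u' x') in U2; rewrite (dC u x) in U3.
have : INR (d x x') <= INR (d u u') + 28 * mu.
  have -> : 28 * mu = INR (28 * m)%N by rewrite INR_muln -/mu /=; lra.
  by rewrite -INR_addn; apply: INR_leq; lia.
have : INR (d u u') <= INR (d x x') + 28 * mu.
  have -> : 28 * mu = INR (28 * m)%N by rewrite INR_muln -/mu /=; lra.
  by rewrite -INR_addn; apply: INR_leq; lia.
by rewrite /Rabs; do 2 case: Rcase_abs; lra.
Qed.

Let same_arc (g : nat -> X) n i i' : geodesic d g n -> (n <= D)%N -> (i <= n)%N -> (i' <= n)%N ->
  INR (d (g i) (g i')) = Rabs (INR i - INR i') /\ Rabs (INR i - INR i') <= delta.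
Proof.
move=> Hg Hn Hi Hi'; rewrite (geodesicE Hd Hg) //.
suff E : INR (i - i' + (i' - i))%N = Rabs (INR i - INR i').
  by rewrite -E; split=> //; apply: INR_leq; lia.
case: (leqP i i') => H.
  have E : i' = (i + (i' - i))%N by lia.
  have := INR_leq H; have := INR_addn i (i' - i); rewrite -E.
  have -> : (i - i' + (i' - i) = i' - i)%N by lia.
  by rewrite /Rabs; case: Rcase_abs; lra.
have E : i = (i' + (i - i'))%N by lia.
have := INR_leq (ltnW H); have := INR_addn i' (i - i'); rewrite -E.
have -> : (i - i' + (i' - i) = i - i')%N by lia.
by rewrite /Rabs; case: Rcase_abs; lra.
Qed.

Let cross_arc i j : (i <= D)%N -> (j <= L)%N ->
  [/\ INR (d (gam i) (sig j)) <= INR i + delta - INR j,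
      INR (d (gam i) (sig j)) <= delta - INR i + INR j + 6 * mu &
      INR i + delta - INR j <= INR (d (gam i) (sig j)) + 106 * mu \/
      delta - INR i + INR j <= INR (d (gam i) (sig j)) + 106 * mu].
Proof.
move=> Hi Hj; have [H1 H2 H3] := cross Hi Hj.
have mulmu k : INR k * mu = INR (k * m)%N by rewrite INR_muln.
set x := d (gam i) (sig j) in H1 H2 H3 *.
split.
- suff : INR x + INR j <= INR i + delta by lra.
  by rewrite /delta -!INR_addn; apply: INR_leq; lia.
- suff : INR x + INR i <= delta + INR j + INR (6 * m)%N by rewrite -mulmu /=; lra.
  by rewrite /delta -!INR_addn; apply: INR_leq; lia.
case: H3 => H3; [left|right].
  suff : INR i + delta <= INR x + INR j + INR (106 * m)%N by rewrite -mulmu /=; lra.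
  by rewrite /delta -!INR_addn; apply: INR_leq; lia.
suff : delta + INR j <= INR x + INR i + INR (106 * m)%N by rewrite -mulmu /=; lra.
by rewrite /delta -!INR_addn; apply: INR_leq; lia.
Qed.

Let circle_arc S S' t t' : 0 <= S < 2 * delta -> 0 <= S' < 2 * delta ->
  Rabs (S - t) <= 7 * mu -> Rabs (S' - t') <= 7 * mu ->
  Rabs (Rmin (Rabs (S - S')) (2 * delta - Rabs (S - S'))
    - Rmin (Rabs (t - t')) (2 * delta - Rabs (t - t'))) <= 14 * mu.
Proof.
move=> HS HS' Ht Ht'.
have : Rabs (S - S') - 14 * mu <= Rabs (t - t') <= Rabs (S - S') + 14 * mu.
  by move: Ht Ht'; rewrite /Rabs; repeat case: Rcase_abs; lra.
move: (Rabs (S - S')) (Rabs (t - t')) => a b Hab.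
by rewrite /Rabs /Rmin; repeat (case: Rcase_abs || case: Rle_dec); lra.
Qed.

(** The [162 * mu] consist of [14 * mu] for the parameters, [28 * mu] for moving to the arcs and
    [120 * mu] for distances between arcs, which covers the [106 * mu] of [cross_arc]. *)
Let corr_distortion x x' s s' : corr x s -> corr x' s' ->
  Rabs (dR x x' - circle_dist s s') <= 162 * mu / delta.
Proof.
case: s => s Hs; case: s' => s' Hs' H H'.
set S := s * delta; set S' := s' * delta.
have HS : 0 <= S < 2 * delta.
  by split; [apply: Rmult_le_pos; lra | apply: Rmult_lt_compat_r; lra].
have HS' : 0 <= S' < 2 * delta.
  by split; [apply: Rmult_le_pos; lra | apply: Rmult_lt_compat_r; lra].
suff main : Rabs (INR (d x x') - Rmin (Rabs (S - S')) (2 * delta - Rabs (S - S'))) <= 162 * mu.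
  have -> : circle_dist (exist _ s Hs) (exist _ s' Hs') =
      Rmin (Rabs (S - S')) (2 * delta - Rabs (S - S')) / delta.
    rewrite /circle_dist /= /S /S' -Rmult_minus_distr_r Rabs_mult (Rabs_pos_eq delta); last lra.
    have -> : 2 * delta - Rabs (s - s') * delta = (2 - Rabs (s - s')) * delta by ring.
    move: (Rabs _) => a; rewrite /Rmin; case: Rle_dec => H1; case: Rle_dec => H2; try by field; lra.
      by case: H2; apply: Rmult_le_compat_r; lra.
    by case: H1; apply: (Rmult_le_reg_r delta); lra.
  rewrite /dR /Rdiv -Rmult_minus_distr_r Rabs_mult (Rabs_pos_eq (/ delta)).
    by apply: Rmult_le_compat_r => //; apply: Rlt_le; apply: Rinv_0_lt_compat; lra.
  by apply: Rlt_le; apply: Rinv_0_lt_compat; lra.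
suff [t [t' [u [u' [Ht Ht' Hu Hu' Htu]]]]] : exists t t' u u',
    [/\ Rabs (S - t) <= 7 * mu, Rabs (S' - t') <= 7 * mu,
       (d x u <= 14 * m)%N, (d x' u' <= 14 * m)%N &
      Rabs (INR (d u u') - Rmin (Rabs (t - t')) (2 * delta - Rabs (t - t'))) <= 120 * mu].
  have N := near_bound Hu Hu' Htu; have A := circle_arc HS HS' Ht Ht'.
  move: N A; set a := Rmin _ _; set b := Rmin _ _.
  by rewrite /Rabs; repeat case: Rcase_abs; lra.
case: H => [[i [Hi Hx Hti]]|[j [Hj Hx Htj]]]; case: H' => [[i' [Hi' Hx' Hti']]|[j' [Hj' Hx' Htj']]].
- exists (INR i), (INR i'), (gam i), (gam i'); split=> //.
  have [-> B] := same_arc Hgam (leqnn _) Hi Hi'.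
  by rewrite Rmin_left; [rewrite Rminus_diag Rabs_R0 | ]; lra.
- exists (INR i), (delta + INR j'), (gam i), (sig j'); split=> //.
  have [] := cross_arc Hi Hj'; have := INR_leq Hi; rewrite -/delta; have := pos_INR j'.
  have : INR j' <= delta by apply: INR_leq; lia.
  have := pos_INR i.
  by rewrite /Rabs /Rmin; repeat (case: Rcase_abs || case: Rle_dec); lra.
- exists (delta + INR j), (INR i'), (sig j), (gam i'); split=> //; rewrite dC.
  have [] := cross_arc Hi' Hj; have := INR_leq Hi'; rewrite -/delta; have := pos_INR j.
  have : INR j <= delta by apply: INR_leq; lia.
  have := pos_INR i'.
  by rewrite /Rabs /Rmin; repeat (case: Rcase_abs || case: Rle_dec); lra.
- exists (delta + INR j), (delta + INR j'), (sig j), (sig j'); split=> //.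
  have [-> B] := same_arc Hsig L_le Hj Hj'.
  have -> : delta + INR j - (delta + INR j') = INR j - INR j' by ring.
  by rewrite Rmin_left; [rewrite Rminus_diag Rabs_R0 | ]; lra.
Qed.

Let dR_metric : is_metric dR.
Proof.
have inv0 : 0 < / delta by apply: Rinv_0_lt_compat; lra.
move=> x y z; rewrite /dR /Rdiv; split; last split; last split.
- by apply: Rmult_le_pos; [exact: pos_INR | lra].
- split=> [/Rmult_integral[|]|->]; [|lra|by rewrite dxx /=; lra].
  by move/(INR_eq _ 0%N); exact: d0.
- by rewrite dC.
rewrite -Rmult_plus_distr_r -INR_addn; apply: Rmult_le_compat_r; first lra.
exact: INR_leq.
Qed.

Lemma GH_lt_circle eps : 243 * INR m < eps * INR D -> GH_lt dR circle_dist eps.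
Proof.
move=> Heps; apply: (GH_lt_of_correspondence dR_metric circle_is_metric _
  corr_total corr_onto corr_distortion).
- by apply: Rdiv_lt_0_compat; lra.
- apply: (Rmult_lt_reg_r delta); first lra.
  have -> : 3 / 2 * (162 * mu / delta) * delta = 243 * mu by field; lra.
  exact: Heps.
- exact: inhabits (gam 0).
Qed.

End Correspondence.

(** * The scaling limit *)

Lemma nat_quasi_isometry_of (T : finType) (e : rel T) C K (Cn Kn : nat) f :
  1 <= C -> C <= INR Cn -> K <= INR Kn ->
  quasi_isometry (graph_metric e) (graph_metric e) C K f ->
  nat_quasi_isometry (gdist e) Cn Kn f.
Proof.
move=> C1 HC HK [f1 f2]; rewrite /graph_metric in f1 f2; split=> [x y|x y|y].
- apply: leq_INR; rewrite INR_muln INR_addn; have [H _] := f1 x y.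
  have D0 := pos_INR (gdist e (f x) (f y)).
  apply: (Rle_trans _ (C * (INR (gdist e (f x) (f y)) + INR Kn))).
    have -> : INR (gdist e x y) = C * (/ C * INR (gdist e x y)) by field; lra.
    by apply: Rmult_le_compat_l; lra.
  by apply: Rmult_le_compat_r => //; have := pos_INR Kn; lra.
- apply: leq_INR; rewrite INR_addn INR_muln; have [_ H] := f1 x y.
  by have := Rmult_le_compat_r _ _ _ (pos_INR (gdist e x y)) HC; lra.
by have [x Hx] := f2 y; exists x; apply: leq_INR; lra.
Qed.

Lemma thin_close_to_circle (T : finType) (e : rel T) (C K Q r : nat) g eps :
  simple_graph e -> graph_connected e -> (0 < C)%N -> (0 < r)%N ->
  (forall x y, exists2 f, nat_quasi_isometry (gdist e) C K f & f x = y) ->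
  (C * (1 + 3 * K) + 3 * K <= r)%N -> (319 * (C * C * C * C) <= Q)%N ->
  thin (gdist e) r (Q.*2.+1 * r + Q) g ->
  (243 * 30 * (C * C * C) * r <= gdiam e)%N ->
  INR (243 * 30 * (C * C * C) * r) < eps * INR (gdiam e) ->
  GH_lt (fun x y => graph_metric e x y / INR (gdiam e)) circle_dist eps.
Proof.
move=> e_simple e_conn C0 r0 Htrans Hr HQ Hthin HD Heps.
have Hd := gdist_path_metric e_simple e_conn.
set m := (14 * C * r).*2.+1.
have Cr : (1 <= C * r)%N by rewrite muln_gt0 C0.
have Hm : (m <= 29 * (C * r))%N by rewrite /m; lia.
have CC : (1 <= C * C)%N by rewrite muln_gt0 C0.
have Km : (K <= m)%N.
  by have := leq_mul C0 (leqnn r); rewrite /m; lia.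
have CCm : (m <= C * C * m)%N by rewrite leq_pmull.
have CCK : (C * C * K <= C * C * m)%N by rewrite leq_mul2l Km orbT.
have Cm : (m <= C * m)%N by rewrite leq_pmull.
have Cmm : (C * m <= C * (C * C * m))%N by rewrite leq_mul2l CCm orbT.
have P3 : (C * C * m <= 29 * (C * C * C * r))%N.
  by have := leq_mul (leqnn (C * C)%N) Hm; lia.
have P4 : (C * (C * C * m) <= 29 * (C * C * C * C * r))%N.
  by have := leq_mul (leqnn C) P3; lia.
(* The source of [319]: [C * (rho + 2 * K)] is at most [22 * 29] times the fourth power of [C] times
   [r], and [22 * 29 = 2 * 319], so [2 * Q * r] suffices. *)
have Q4 : (319 * (C * C * C * C) * r <= Q * r)%N by rewrite leq_mul2r HQ orbT.
have CK : (C * K <= C * m)%N by rewrite leq_mul2l Km orbT.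
have CrC : (r <= C * r)%N by rewrite leq_pmull.
(* Large enough for [20 * m] and for the distorted distance [C * (C * (6 * m + K)) + K] plus
   [5 * m]. *)
pose rho := (20 * (C * C * m))%N.
have loc y : tripod_free (gdist e) rho (14 * C * r) y /\
    two_sided (gdist e) rho (14 * C * r) (6 * m) (C * (C * (6 * m + K)) + K) y.
  have [f Hf fy] := Htrans (g (Q.*2.+1 * r + Q)%N) y.
  apply: (thin_transfer (X := T) Hd C0 Hr _ _ _ _ Hthin Hf fy) => //.
  - by rewrite /rho; lia.
  - by rewrite /m; lia.
  - by lia.
  - by rewrite /rho; lia.
have [x0] : inhabited T by exact: inhabits (g 0%N).
have [|a [b Hab]] := @gdiam_attained T e; first by apply/card_gt0P; exists x0.
have [_ _ _ dG] := Hd.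
have [gam [Hgam _ _]] := dG a b; rewrite Hab in Hgam.
have [|||L [sig [Hsig L1 L2 cov cro]]] := @circular_shape T _ Hd (14 * C * r) rho
  (C * (C * (6 * m + K)) + K) _ _ (fun q => proj1 (loc q)) (fun q => proj2 (loc q))
  (gdiam e) gam (gdist_le_gdiam e) Hgam.
- by rewrite -/m /rho; lia.
- by rewrite -/m /rho; lia.
- by rewrite /rho; lia.
apply: (GH_lt_circle Hd (gdist0 e_conn) _ (ltn0Sn _) Hgam Hsig L1 L2 cov cro); first by lia.
apply: Rle_lt_trans Heps; have -> : 243 = INR 243 by rewrite /=; lra.
by rewrite -INR_muln; apply: INR_leq; rewrite -/m; lia.
Qed.

Lemma bounded_on_initial_segment (F : nat -> R) n : exists B, forall i, (i <= n)%N -> F i <= B.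
Proof.
elim: n => [|n [B HB]]; first by exists (F 0%N) => i; rewrite leqn0 => /eqP->; lra.
exists (Rmax B (F n.+1)) => i Hi; case: (eqVneq i n.+1) => [->|Hne]; first exact: Rmax_r.
by apply: Rle_trans (Rmax_l _ _); apply: HB; lia.
Qed.

Lemma nat_above x : exists n : nat, x <= INR n.
Proof. by have [n Hn] := INR_unbounded x; exists n; lra. Qed.

(** * Logarithms and the growth exponent *)

Lemma ln_le x y : 0 < x -> x <= y -> ln x <= ln y.
Proof.
by move=> x0 [xy|->]; [apply: Rlt_le; apply: ln_increasing | apply: Rle_refl].
Qed.

Lemma ln_expn (a k : nat) : (0 < a)%N -> ln (INR (a ^ k)%N) = INR k * ln (INR a).
Proof.
move=> Ha; elim: k => [|k IH]; first by rewrite expn0 /= ln_1; lra.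
have Ra : 0 < INR a by apply: (lt_INR 0); apply/ltP.
have Rk : 0 < INR (a ^ k)%N by apply: (lt_INR 0); apply/ltP; rewrite expn_gt0 Ha.
by rewrite expnS INR_muln ln_mult // IH S_INR; lra.
Qed.

(** If no scale up to about [sqrt D] is thin, the order is at least about [D] times [(2Q+2)/(2Q+1)]
    to the power [k], with [(2Q+1) ^ k] about [sqrt D]. This exceeds the exponent [1] by a fraction
    with denominator [2 * ln (2Q+1)]; half of that excess is taken. *)
Definition growth_exponent (Q : nat) :=
  1 + (ln (INR Q.*2.+2) - ln (INR Q.*2.+1)) / (4 * ln (INR Q.*2.+1)).

(* Comparing logarithms, a graph that is not thin at the first [k] scales, where [scale k] is of
   order [sqrt D], has so many vertices that [k] is bounded. *)
Lemma few_fat_scales (Q r0 : nat) A : (0 < Q)%N -> exists k1 : nat, forall (k D N : nat),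
  ((scale Q r0 k).*2.+1 ^ 2 <= D)%N -> (D < (scale Q r0 k.+1).*2.+1 ^ 2)%N ->
  (D.+1 %/ (scale Q r0 k).*2.+1 * Q.*2.+2 ^ k <= N)%N ->
  INR N <= A * Rpower (INR D) (growth_exponent Q) -> (k < k1)%N.
Proof.
move=> Q0.
set lam := ln (INR Q.*2.+1); set theta := ln (INR Q.*2.+2) - lam.
have pos n : (0 < n)%N -> 0 < INR n by move=> H; apply: (lt_INR 0); apply/ltP.
have lnle a b : (0 < a)%N -> (a <= b)%N -> ln (INR a) <= ln (INR b).
  by move=> a0 ab; apply: ln_le; [exact: pos | exact: INR_leq].
have lam0 : 0 < lam by rewrite -ln_1; apply: ln_increasing; [lra | apply: (lt_INR 1); apply/ltP; lia].
have theta0 : 0 < theta.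
  by apply/Rlt_0_minus; apply: ln_increasing; [exact: pos | apply: lt_INR; apply/ltP; lia].
pose l0 := ln (INR r0.*2.+1).
have [k1 Hk1] := nat_above ((2 * (ln 2 + l0 + ln A) / theta + l0 / lam + 1) + 1).
exists k1 => k D N HD1 HD2 HN HA.
rewrite ltnNge; apply/negP => /INR_leq Hk.
have sE i : (scale Q r0 i).*2.+1 = (Q.*2.+1 ^ i * r0.*2.+1)%N := scaleE Q r0 i.
set l := (scale Q r0 k).*2.+1 in HD1 HN *.
have l_gt0 : (0 < l)%N by [].
have D_ge_l : (l <= D)%N by apply: leq_trans HD1; rewrite -mulnn leq_pmull.
have D0 : (0 < D)%N by lia.
have lnl : ln (INR l) = INR k * lam + l0.
  by rewrite /l sE INR_muln ln_mult ?ln_expn //; apply: pos => //; rewrite expn_gt0.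
have two : INR 2 = 2 by rewrite /=; lra.
have lnD : ln (INR D) <= 2 * ((INR k + 1) * lam + l0).
  apply: Rle_trans (lnle _ _ D0 (ltnW HD2)) _.
  rewrite ln_expn // sE INR_muln ln_mult ?ln_expn //; first by rewrite two -/lam -/l0 S_INR; lra.
    by apply: pos; rewrite expn_gt0.
  exact: pos.
have count : (D * Q.*2.+2 ^ k <= 2 * l * N)%N.
  apply: leq_trans (_ : (2 * l * (D.+1 %/ l * Q.*2.+2 ^ k) <= _)%N); last by rewrite leq_mul2l HN orbT.
  rewrite mulnA leq_mul2r; apply/orP; right.
  have := divn_eq D.+1 l; have := ltn_pmod D.+1 l_gt0.
  have : (1 * l <= D.+1 %/ l * l)%N by rewrite leq_mul2r divn_gt0 //; lia.
  lia.
have N0 : (0 < N)%N.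
  rewrite lt0n; apply/eqP => E; move: count; rewrite E muln0 leqn0 muln_eq0 expn_eq0.
  by lia.
have RN := pos _ N0.
have P0 : 0 < Rpower (INR D) (growth_exponent Q) by exact: exp_pos.
have A0 : 0 < A.
  by apply: (Rmult_lt_reg_r (Rpower (INR D) (growth_exponent Q))); lra.
have lnN : ln (INR N) <= ln A + growth_exponent Q * ln (INR D).
  apply: Rle_trans (ln_le RN HA) _; rewrite ln_mult // /Rpower ln_exp; lra.
have lncount : ln (INR D) + INR k * (lam + theta) <= ln 2 + ln (INR l) + ln (INR N).
  have c0 : (0 < D * Q.*2.+2 ^ k)%N by rewrite muln_gt0 D0 expn_gt0.
  have := lnle _ _ c0 count; rewrite !INR_muln !ln_mult ?ln_expn //; try by apply: pos.
  - have -> : ln (INR Q.*2.+2) = lam + theta by rewrite /theta; lra.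
    by rewrite two.
  - by apply: Rmult_lt_0_compat; apply: pos.
  - by apply: pos; rewrite expn_gt0.
have gE : growth_exponent Q = 1 + theta / (4 * lam) by [].
have q0 : 0 < theta / (4 * lam) by apply: Rdiv_lt_0_compat; lra.
have M := Rmult_le_compat_l _ _ _ (Rlt_le _ _ q0) lnD.
have E1 : theta / (4 * lam) * (2 * ((INR k + 1) * lam + l0)) =
    theta / 2 * (INR k + 1 + l0 / lam) by field; lra.
rewrite E1 in M; rewrite gE in lnN.
(* Having taken half the excess leaves only [theta / 2] per scale on the right, so [k] is
   bounded. *)
have F : INR k * theta <= ln 2 + l0 + ln A + theta / 2 * (INR k + 1 + l0 / lam) by lra.
have : INR k <= 2 * (ln 2 + l0 + ln A) / theta + l0 / lam + 1.
  apply: (Rmult_le_reg_r theta) => //.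
  have -> : (2 * (ln 2 + l0 + ln A) / theta + l0 / lam + 1) * theta =
    2 * (ln 2 + l0 + ln A) + theta * (l0 / lam) + theta by field; lra.
  lra.
lra.
Qed.

(** * Choice of the scale and conclusion *)

Lemma scale_mono Q r0 i k : (i <= k)%N -> (scale Q r0 i <= scale Q r0 k)%N.
Proof.
by elim: k => [|k IH]; rewrite ?leqn0; [move/eqP-> | rewrite leq_eqVlt => /orP[/eqP->//|/IH /=]; lia].
Qed.

Lemma scale_ge Q r0 k : (0 < Q)%N -> (k <= scale Q r0 k)%N.
Proof. by move=> Q0; elim: k => //= k IH; lia. Qed.

Lemma scale_below_sqrt Q r0 k1 D : (0 < Q)%N -> ((scale Q r0 k1).*2.+1 ^ 2 <= D)%N ->
  exists k, [/\ (k1 <= k)%N, ((scale Q r0 k).*2.+1 ^ 2 <= D)%N &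
    (D < (scale Q r0 k.+1).*2.+1 ^ 2)%N].
Proof.
move=> Q0 H1; pose P k := ((scale Q r0 k).*2.+1 ^ 2 <= D)%N.
have bound k : P k -> (k <= D)%N.
  rewrite /P => Hk; apply: leq_trans Hk; have := scale_ge r0 k Q0.
  have : ((scale Q r0 k).*2.+1 ^ 1 <= (scale Q r0 k).*2.+1 ^ 2)%N by rewrite leq_pexp2l.
  by rewrite expn1; lia.
case: (ex_maxnP (ex_intro P k1 H1) bound) => k Pk kmax.
exists k; split=> //; first exact: kmax.
by rewrite ltnNge; apply/negP => /kmax; lia.
Qed.

Theorem theorem3 :
  forall C K : R, 1 <= C -> 0 <= K ->
  exists delta : R, 1 < delta /\
  forall (T : nat -> finType) (E : forall n : nat, rel (T n)),
    (forall n : nat, simple_graph (E n)) ->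
    (forall n : nat, graph_connected (E n)) ->
    (forall n : nat, roughly_transitive (graph_metric (E n)) C K) ->
    (* |X_n| -> infinity *)
    (forall M : R, exists N : nat, forall n : nat, leq N n -> M <= INR #|T n|) ->
    (* |X_n| = O(diam(X_n)^delta) *)
    (exists (A : R) (N : nat), forall n : nat, leq N n ->
        INR #|T n| <= A * Rpower (INR (gdiam (E n))) delta) ->
    scaling_limit_is E circle_dist.
Proof.
move=> C K C1 K0.
have [Cn HC] := nat_above C; have [Kn HK] := nat_above K.
have Cn0 : (0 < Cn)%N by apply: (@leq_INR 1); rewrite /=; lra.
pose Q := (319 * (Cn * Cn * Cn * Cn))%N; pose r0 := (Cn * (1 + 3 * Kn) + 3 * Kn)%N.
have Q0 : (0 < Q)%N by rewrite /Q !muln_gt0 Cn0.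
have r00 : (0 < r0)%N by rewrite /r0 addn_gt0 muln_gt0 Cn0.
exists (growth_exponent Q); split.
  have H0 : 0 < ln (INR Q.*2.+1).
    by rewrite -ln_1; apply: ln_increasing; [lra | apply: (lt_INR 1); apply/ltP; lia].
  have H1 : ln (INR Q.*2.+1) < ln (INR Q.*2.+2).
    by apply: ln_increasing; [apply: (lt_INR 0); apply/ltP | apply: lt_INR; apply/ltP; lia].
  by rewrite /growth_exponent; have := @Rdiv_lt_0_compat (ln (INR Q.*2.+2) - ln (INR Q.*2.+1))
    (4 * ln (INR Q.*2.+1)); lra.
move=> T E E_simple E_conn E_trans E_large [A [N0 HA]] eps eps0.
pose B := (243 * 30 * (Cn * Cn * Cn))%N.
have [k1 Hk1] := few_fat_scales r0 A Q0.
have [k2 Hk2] := nat_above (INR B / eps + 1).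
(* [k1] forces a thin scale, [k2] brings the error below [eps], and [B] makes the diameter large
   against that scale. *)
pose k3 := (k1 + k2 + B)%N.
pose D0 := ((scale Q r0 k3).*2.+1 ^ 2)%N.
(* Diameters up to [D0] would bound the number of vertices, which tends to infinity. The [1] in the
   next maximum makes the graph nonempty. *)
have [M HM] := bounded_on_initial_segment (fun D => A * Rpower (INR D) (growth_exponent Q)) D0.
have [N1 HN1] := E_large (Rmax (M + 1) 1).
exists (N0 + N1)%N => n Hn.
have HAn := HA n ltac:(lia).
have HM1 := Rle_trans _ _ _ (Rmax_l _ _) (HN1 n ltac:(lia)).
have HN1' := Rle_trans _ _ _ (Rmax_r _ _) (HN1 n ltac:(lia)).
set D := gdiam (E n) in HAn.
have HD : (D0 <= D)%N.
  by case: (leqP D0 D) => // /ltnW /HM /=; lra.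
have [k [Hk HkD HkD']] := scale_below_sqrt Q0 HD.
have Hd := gdist_path_metric (E_simple n) (E_conn n).
(* Otherwise no scale below [k] is thin, and counting vertices gives [k < k1]. *)
have [i Hi [g Hg]] : exists2 i, (i < k)%N &
    exists g, thin (gdist (E n)) (scale Q r0 i) (scale Q r0 i.+1) g.
  apply: NNPP => Hno.
  have [|a [b Hab]] := @gdiam_attained (T n) (E n).
    exact: (@leq_INR 1).
  have [_ _ _ dG] := Hd; have [gam [Hgam _ _]] := dG a b; rewrite Hab in Hgam.
  have Hgr := order_growth Hd (Q := Q) (r0 := r0) (k := k) _ Hgam.
  have : (k < k1)%N.
    apply: (Hk1 _ _ _ HkD HkD' (Hgr _) HAn) => i Hi g Hg.
    by apply: Hno; exists i => //; exists g.
  by lia.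
have Hr := scale_mono Q r0 (leq0n i); have Hl := scale_mono Q r0 (ltnW Hi).
set r := scale Q r0 i in Hr Hl *; set l := (scale Q r0 k).*2.+1 in HkD.
have Hl' : (r <= l)%N by rewrite /l; lia.
have kl : (k <= l)%N by have := scale_ge r0 k Q0; rewrite /l; lia.
(* Here [B <= k], and both [k] and the thin scale [r] are at most [l], whose square is at most
   [D]. *)
have BrD : (B * r <= k * r)%N by rewrite leq_mul2r; lia.
have krD : (k * r <= D)%N by apply: leq_trans HkD; rewrite -mulnn leq_mul.
apply: (@thin_close_to_circle _ _ Cn Kn Q r g) => //.
- by move: Hr; rewrite /=; lia.
- move=> x y; have [f [Hf fx]] := E_trans n x y; exists f => //.
  exact: nat_quasi_isometry_of Hf.
- exact: leq_trans krD.
have H1 : INR B < eps * INR k.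
  have : INR k2 <= INR k by apply: INR_leq; lia.
  move=> Hkk; have E1 : INR B = eps * (INR B / eps) by field; lra.
  by rewrite E1; apply: Rmult_lt_compat_l; lra.
apply: Rlt_le_trans (_ : eps * INR (k * r)%N <= _).
  rewrite (INR_muln B r) (INR_muln k r) -Rmult_assoc; apply: Rmult_lt_compat_r => //.
  by apply: (lt_INR 0); apply/ltP; move: Hr; rewrite /=; lia.
by apply: Rmult_le_compat_l; [lra | exact: INR_leq].
Qed.
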